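(* (i) For every recursively enumerable set $A\subseteq\mathbb{N}=\{0,1,2,\ldots\}$ there is an exponential diophantine equation $F(x,x_1,\ldots,x_{10})=0$ such that for every $a\in\mathbb{N}$: $a\in A$ if and only if $F(a,x_1^2,\ldots,x_{10}^2)=0$ for some $x_1,\ldots,x_{10}\in\mathbb{Q}$. (ii) There is no algorithm which, given an arbitrary exponential diophantine equation $F(x_1,\ldots,x_{10})=0$ in ten unknowns, decides whether the equation $F(x_1^2,\ldots,x_{10}^2)=0$ has a solution $(x_1,\ldots,x_{10})\in\mathbb{Q}^{10}$.
   Context: An exponential diophantine equation is an equation of the form $F_1(x_1,\ldots,x_n)-F_2(x_1,\ldots,x_n)=0$, where $F_1,F_2$ are expressions built from the variables and particular natural numbers using addition, multiplication and exponentiation; $0^0$ is regarded as $1$. When such equations are considered over $\mathbb{Q}$, the exponential $x^y$ is used only for $x\ge 0$ and $y\ge 0$ (so it is the real number $x^y$); a rational tuple is a solution if every exponentiation occurring in the evaluation has nonnegative base and nonnegative exponent and the resulting real-valued equation holds. *)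

(* Defs.v *)
From HB Require Import structures.
From mathcomp Require Import all_boot all_order all_algebra.
From mathcomp Require Import reals exp.

Set Implicit Arguments.
Unset Strict Implicit.
Unset Printing Implicit Defensive.

Import Order.TTheory GRing.Theory Num.Theory.

Local Open Scope ring_scope.

(** * Exponential diophantine equations *)

Inductive expr (n : nat) : Type :=
| Var of 'I_n
| Cst of nat
| Add of expr n & expr n
| Mul of expr n & expr n
| Pow of expr n & expr n.

Arguments Cst {n} _.

(* [EDEq F1 F2] is the equation F1 - F2 = 0. *)
Record edeq (n : nat) : Type := EDEq { pos_part : expr n ; neg_part : expr n }.

(* [powR] satisfies 0 `^ 0 = 1 and 0 `^ y = 0 for y != 0.  Its values at a
   negative base or a negative exponent are excluded by [admissible]. *)
Fixpoint eval (R : realType) (n : nat) (v : n.-tuple rat) (e : expr n) : R :=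
  match e with
  | Var i => ratr (tnth v i)
  | Cst k => k%:R
  | Add e1 e2 => eval R v e1 + eval R v e2
  | Mul e1 e2 => eval R v e1 * eval R v e2
  | Pow e1 e2 => powR (eval R v e1) (eval R v e2)
  end.

Fixpoint admissible (R : realType) (n : nat) (v : n.-tuple rat) (e : expr n)
    : Prop :=
  match e with
  | Var _ | Cst _ => True
  | Add e1 e2 | Mul e1 e2 => admissible R v e1 /\ admissible R v e2
  | Pow e1 e2 => [/\ admissible R v e1, admissible R v e2,
                     0 <= eval R v e1 & 0 <= eval R v e2]
  end.

Definition solution (R : realType) (n : nat) (F : edeq n) (v : n.-tuple rat)
    : Prop :=
  [/\ admissible R v (pos_part F), admissible R v (neg_part F)
    & eval R v (pos_part F) - eval R v (neg_part F) = 0].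

Definition squares (n : nat) (x : n.-tuple rat) : n.-tuple rat :=
  [tuple tnth x i ^+ 2 | i < n].

(** * Partial recursive functions *)

Local Open Scope nat_scope.

Inductive recfun : nat -> Type :=
| RZero n : recfun n
| RSucc : recfun 1
| RProj n of 'I_n : recfun n
| RComp m n of recfun m & ('I_m -> recfun n) : recfun n
| RPrec n of recfun n & recfun n.+2 : recfun n.+1
| RMin n of recfun n.+1 : recfun n.

(* [rec_value f v y]: the partial function f is defined at v, with value y.
   - [RPrec f g] is the h with h(0, v) = f(v), h(k+1, v) = g(k, h(k, v), v);
     the sequence s below lists h(0, v), h(1, v), ...
   - [RMin f] maps v to the least y with f(y, v) = 0, where moreover f(z, v)
     is required to be defined for every z < y. *)
Fixpoint rec_value (n : nat) (f : recfun n) : n.-tuple nat -> nat -> Prop :=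
  match f in recfun n return n.-tuple nat -> nat -> Prop with
  | RZero _ => fun _ y => y = 0
  | RSucc => fun v y => y = (thead v).+1
  | RProj _ i => fun v y => y = tnth v i
  | RComp m _ f g => fun v y =>
      exists w : m.-tuple nat,
        (forall i, rec_value (g i) v (tnth w i)) /\ rec_value f w y
  | RPrec _ f g => fun v y =>
      exists s : nat -> nat,
        [/\ rec_value f [tuple of behead v] (s 0),
            forall k, k < thead v ->
              rec_value g [tuple of [:: k, s k & behead v]] (s k.+1)
          & y = s (thead v)]
  | RMin _ f => fun v y =>
      rec_value f [tuple of y :: v] 0 /\
      forall z, z < y -> exists k, rec_value f [tuple of z :: v] k.+1
  end.

Definition recursively_enumerable (A : nat -> Prop) : Prop :=
  exists f : recfun 1, forall a, A a <-> exists y, rec_value f [tuple a] y.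

(** * Goedel numbering of equations *)

(* Cantor's pairing function (a + b)(a + b + 1) / 2 + b. *)
Definition cantor (a b : nat) : nat := 'C((a + b).+1, 2) + b.

Fixpoint expr_code (n : nat) (e : expr n) : nat :=
  match e with
  | Var i => cantor 0 i
  | Cst k => cantor 1 k
  | Add e1 e2 => cantor 2 (cantor (expr_code e1) (expr_code e2))
  | Mul e1 e2 => cantor 3 (cantor (expr_code e1) (expr_code e2))
  | Pow e1 e2 => cantor 4 (cantor (expr_code e1) (expr_code e2))
  end.

Definition edeq_code (n : nat) (F : edeq n) : nat :=
  cantor (expr_code (pos_part F)) (expr_code (neg_part F)).

Lemma cantor_inj a b c d : cantor a b = cantor c d -> a = c /\ b = d.
Proof.
have step m p : m < p -> 'C(m.+1, 2) + m < 'C(p.+1, 2).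
  move=> lt_mp; have : 'C(m.+2, 2) <= 'C(p.+1, 2) by apply: leq_bin2l.
  by rewrite binS bin1 addnS.
have lt_pair i j k l : i + j < k + l -> cantor i j < cantor k l.
  move=> /step lt_C; apply: leq_trans (leq_addr _ _).
  by apply: leq_ltn_trans lt_C; rewrite leq_add2l leq_addl.
move=> eq_p; case: (ltngtP (a + b) (c + d)) => [/lt_pair|/lt_pair|eq_s].
- by rewrite eq_p ltnn.
- by rewrite eq_p ltnn.
move: eq_p; rewrite /cantor eq_s => /addnI eq_b.
by split=> //; move: eq_s; rewrite eq_b => /addIn.
Qed.

Lemma expr_code_inj n : injective (@expr_code n).
Proof.
elim=> [i|k|e1 IH1 e2 IH2|e1 IH1 e2 IH2|e1 IH1 e2 IH2];
  case=> [j|l|f1 f2|f1 f2|f1 f2] /= /cantor_inj [] // _.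
- by move=> /val_inj ->.
- by move=> ->.
all: by move=> /cantor_inj [/IH1 -> /IH2 ->].
Qed.

Lemma edeq_code_inj n : injective (@edeq_code n).
Proof.
by case=> [p q] [r s] /cantor_inj /= [/expr_code_inj -> /expr_code_inj ->].
Qed.

(* P is decided by an algorithm: some partial recursive function halts on the
   code of every equation, with value 1 if P holds and 0 otherwise; its
   behaviour on numbers that are not codes is irrelevant. *)
Definition decidable_edeq (n : nat) (P : edeq n -> Prop) : Prop :=
  exists f : recfun 1, forall F : edeq n,
    (P F -> rec_value f [tuple edeq_code F] 1) /\
    (~ P F -> rec_value f [tuple edeq_code F] 0).

(* Main.v *)
From HB Require Import structures.
Require Import Defs.
From mathcomp Require Import all_boot all_order all_algebra.
From mathcomp Require Import reals exp boolp.
From mathcomp Require Import zify ring lra.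

(** By real exponentiation, y^(1/2) is an expression as soon as 1/4 is a square of
    an unknown, so squares of rationals stand for arbitrary nonnegative
    rationals; and if q_1, ..., q_8 >= 0 and 2^q_1 3^q_2 ... 19^q_8 are rational
    then the q_k are integers.  This leaves eight unknowns that range over the
    natural numbers, for an arbitrary recursively enumerable set.

    A partial recursive function is run by a nondeterministic counter program,
    whose computations are encoded by the bit tables ("tilings") of width n, read
    row by row as a single word, such that every window of bits at cells p, p + 1,
    p + n, p + n + 1 is allowed.  Writing the word and its complement as numbers
    W and V with sparse binary digits, "every window differs from rho" says that
    certain bits of a sum of shifted copies of W and V are all 1.  Such a
    masking relation between R and S holds iff 'C(S, R) is odd, and all of them
    can be stacked into one.  The unknowns are the width, the position of the last
    row, a geometric sum I giving the positions of the cells, W, V, and three for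
    the parity of the binomial coefficient, which is read off (1 + U)^S in base
    U = 2^(S+1).

    For undecidability, a decision procedure f would make
    {F | f (F with its own code as first argument) = 0} recursively enumerable,
    hence given by an equation, which contradicts f at that equation. *)

Set Implicit Arguments.
Unset Strict Implicit.
Unset Printing Implicit Defensive.

Import Order.TTheory GRing.Theory Num.Theory.
Local Open Scope nat_scope.

(** * Binomial coefficients modulo 2 *)

(** Lucas's theorem modulo 2, one binary digit at a time. Pascal's rule applied twice has an even
    middle term, so the induction can move two steps at once. *)
Lemma odd_bin_double (a b : nat) (c d : bool) :
  odd 'C(d + b.*2, c + a.*2) = odd 'C(b, a) && (c ==> d).
Proof.
have step n k : odd 'C(n.+2, k.+2) = odd 'C(n, k.+2) (+) odd 'C(n, k).
  by rewrite !binS !oddD; case: (odd _); case: (odd _); case: (odd _).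
elim: b a c d => [|b IHb] [|a] c d.
- by rewrite !addn0; case: c; case: d.
- by rewrite doubleS !addn0 !addnS bin_small ?bin0n //; case: d; lia.
- by case: c; rewrite ?bin0 ?bin1 ?oddD ?odd_double //=; case: d.
- by rewrite !doubleS !addnS step -!addnS -doubleS !IHb binS oddD -andb_addl.
Qed.

Lemma odd_bin_split (k a0 a1 b0 b1 : nat) : a0 < 2 ^ k -> b0 < 2 ^ k ->
  odd 'C(b0 + 2 ^ k * b1, a0 + 2 ^ k * a1) = odd 'C(b0, a0) && odd 'C(b1, a1).
Proof.
elim: k a0 b0 => [|k IHk] a0 b0.
  by rewrite expn0 !ltnS !leqn0 => /eqP-> /eqP->; rewrite !mul1n.
rewrite !expnS => lt_a lt_b.
rewrite -(odd_double_half a0) -(odd_double_half b0) -!addnA.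
rewrite -!mulnA !mul2n -!doubleD !odd_bin_double IHk; [|lia|lia].
by rewrite andbAC.
Qed.

(** * Expansions in base B *)

Definition digits_val (B H : nat) (f : nat -> nat) := \sum_(d < H) f d * B ^ d.

Lemma digits_valS B H f :
  digits_val B H.+1 f = f 0 + B * digits_val B H (fun d => f d.+1).
Proof.
rewrite /digits_val big_ord_recl expn0 muln1; congr (_ + _).
by rewrite big_distrr; apply: eq_bigr => d _; rewrite /= expnS mulnCA.
Qed.

Lemma odd_bin_digits (k H : nat) (f g : nat -> nat) :
  (forall d, f d < 2 ^ k) -> (forall d, g d < 2 ^ k) ->
  odd 'C(digits_val (2 ^ k) H g, digits_val (2 ^ k) H f) <->
  forall d, d < H -> odd 'C(g d, f d).
Proof.
elim: H f g => [|H IHH] f g lt_f lt_g.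
  by rewrite /digits_val !big_ord0; split.
rewrite !digits_valS odd_bin_split //; split=> [/andP[o0 oS] [|d] // lt_d|all_o].
  by move: d lt_d; apply/IHH.
apply/andP; split; first exact: all_o.
by apply/IHH => // d lt_d; apply: all_o.
Qed.

Lemma digits_val_lt B H f : (forall d, f d < B) -> digits_val B H f < B ^ H.
Proof.
elim: H f => [|H IHH] f lt_f; first by rewrite /digits_val big_ord0.
rewrite digits_valS expnS.
have := IHH _ (fun d => lt_f d.+1); have := lt_f 0.
set x := digits_val _ _ _ => lt0 ltx.
apply: (@leq_trans (B * x.+1)); last by rewrite leq_mul2l ltx orbT.
by rewrite mulnS -addSn leq_add2r.
Qed.

Lemma digits_val_divn B H W : 0 < B -> W < B ^ H ->
  W = digits_val B H (fun d => W %/ B ^ d %% B).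
Proof.
move=> B0; elim: H W => [|H IHH] W.
  by rewrite /digits_val big_ord0 expn0 ltnS leqn0 => /eqP.
move=> ltW; rewrite digits_valS expn0 divn1 {1}(divn_eq W B) addnC; congr (_ + _).
have {1}-> : W %/ B = digits_val B H (fun d => W %/ B %/ B ^ d %% B).
  by apply: IHH; rewrite ltn_divLR // mulnC -expnS.
rewrite mulnC; congr (_ * _); apply: eq_bigr => d _.
by rewrite expnS divnMA.
Qed.

(* With U even, the quotient of (1 + U)^S by U^R has the parity of 'C(S, R). *)
Lemma odd_bin_power (S R : nat) (U := 2 ^ S.+1) :
  odd 'C(S, R) <->
  exists m r s, (1 + U) ^ S = (2 * m + 1) * U ^ R + r /\ r + s + 1 = U ^ R.
Proof.
have U0 : 0 < U ^ R by rewrite expn_gt0 expn_gt0.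
have even_U : odd U = false by rewrite oddX.
(* Every coefficient is at most [2 ^ S], so the coefficients are the base-U digits of
   [(1 + U) ^ S]. *)
have lt_bin i : 'C(S, i) < U.
  apply: (@leq_ltn_trans (2 ^ S)); last by rewrite ltn_exp2l.
  case: (leqP i S) => [le_iS|/bin_small-> //].
  by rewrite -[2]/(1 + 1) expnDn (bigD1 (Ordinal (le_iS : i < S.+1))) //= !exp1n !muln1 leq_addr.
set q := \sum_(i < S) 'C(S, R + i.+1) * U ^ i.
have eq_pow : (1 + U) ^ S =
    ('C(S, R) + U * q) * U ^ R + digits_val U R (fun i => 'C(S, i)).
  rewrite expnDn.
  have -> : \sum_(i < S.+1) 'C(S, i) * (1 ^ (S - i) * U ^ i) =
            \sum_(i < R + S.+1) 'C(S, i) * U ^ i.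
    rewrite [in RHS]addnC big_split_ord /= [X in _ = _ + X]big1 ?addn0.
      by apply: eq_bigr => i _; rewrite exp1n mul1n.
    by move=> i _; rewrite bin_small // addSn ltnS leq_addr.
  rewrite big_split_ord /= addnC; congr (_ + _).
  rewrite big_ord_recl addn0 mulnDl; congr (_ + _).
  rewrite mulnC mulnA big_distrr /=.
  apply: eq_bigr => i _; rewrite /bump /= add1n expnD expnS -mulnA mulnCA.
  by congr (_ * _); rewrite mulnCA.
have lt_lo := digits_val_lt R lt_bin.
have odd_q : odd ((1 + U) ^ S %/ U ^ R) = odd 'C(S, R).
  by rewrite eq_pow divnMDl // divn_small // addn0 oddD oddM even_U addbF.
split=> [o|[m [r [s [eq_m eq_s]]]]].
  rewrite -odd_q in o; set Q := _ %/ _ in o.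
  (* The quotient Q is odd, so m is its half; s records that the remainder r is below [U ^ R]. *)
  exists Q./2, ((1 + U) ^ S %% U ^ R), (U ^ R - ((1 + U) ^ S %% U ^ R).+1).
  have lt_mod : (1 + U) ^ S %% U ^ R < U ^ R by rewrite ltn_mod.
  split; last by rewrite -addnA [_ + 1]addn1 addnS -addSn subnKC.
  rewrite [LHS](divn_eq _ (U ^ R)); congr (_ * _ + _).
  by rewrite -/Q -[LHS]odd_double_half o addnC mul2n.
rewrite -odd_q eq_m divnMDl // divn_small; last by rewrite -eq_s addn1 ltnS leq_addr.
by rewrite addn0 oddD oddM.
Qed.

Lemma digits_val_ext B H f g :
  (forall d, d < H -> f d = g d) -> digits_val B H f = digits_val B H g.
Proof. by move=> eq_fg; apply: eq_bigr => d _; rewrite eq_fg. Qed.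

Lemma digits_valD B H f g :
  digits_val B H (fun d => f d + g d) = digits_val B H f + digits_val B H g.
Proof. by rewrite -big_split; apply: eq_bigr => d _; rewrite mulnDl. Qed.

Lemma digits_valM B H c f :
  digits_val B H (fun d => c * f d) = c * digits_val B H f.
Proof. by rewrite /digits_val big_distrr; apply: eq_bigr => d _; rewrite /= mulnA. Qed.

Lemma digits_val_sum (I : finType) B H (f : I -> nat -> nat) :
  digits_val B H (fun d => \sum_i f i d) = \sum_i digits_val B H (f i).
Proof.
rewrite /digits_val [RHS]exchange_big; apply: eq_bigr => d _ /=.
by rewrite big_distrl.
Qed.

(** Multiplying by [B ^ s] moves every digit up by s; since the top s digits vanish, the result
    still has H digits. *)
Lemma digits_val_shift B H s f :
  (forall d, H <= d + s -> f d = 0) ->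
  B ^ s * digits_val B H f = digits_val B H (fun d => (s <= d) * f (d - s)).
Proof.
elim: s f => [|s IHs] f f0.
  by rewrite expn0 mul1n; apply: digits_val_ext => d _; rewrite leq0n mul1n subn0.
(* [g] is [f] with a zero digit put below it, which reduces a shift by s + 1 to a shift by s. *)
pose g d := if d is d'.+1 then f d' else 0.
have -> : digits_val B H (fun d => (s.+1 <= d) * f (d - s.+1)) =
    digits_val B H (fun d => (s <= d) * g (d - s)).
  apply: digits_val_ext => d _.
  case: (leqP s d) => [le_sd|]; last by move=> lt_ds; rewrite ltnNge ltnW.
  case E: (d - s) => [|k]; first by have -> : (s < d) = false by lia.
  have -> : d - s.+1 = k by lia.
  by congr (nat_of_bool _ * _); lia.
rewrite -IHs; last by case=> [|d] // le_H; apply: f0; lia.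
rewrite expnSr -mulnA; congr (_ * _).
case: H f0 {IHs} => [|H] f0; first by rewrite /digits_val !big_ord0 muln0.
rewrite [RHS]digits_valS add0n; congr (_ * _).
rewrite /digits_val big_ord_recr /= f0 ?addn0 //; lia.
Qed.

Lemma digits_val1 B H c : c < H -> digits_val B H (fun d => (d == c)) = B ^ c.
Proof.
move=> lt_c; rewrite /digits_val (bigD1 (Ordinal lt_c)) //= eqxx mul1n big1 ?addn0 //.
by move=> i; rewrite -val_eqE /= => /negPf->.
Qed.

Lemma digits_val_widen B H0 H f : H0 <= H -> (forall d, H0 <= d -> f d = 0) ->
  digits_val B H f = digits_val B H0 f.
Proof.
move=> le_H f0; rewrite /digits_val -(subnKC le_H) big_split_ord /=.
by rewrite [X in _ + X]big1 ?addn0 // => i _; rewrite f0 ?leq_addr.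
Qed.

(** One exponential equation pins down the geometric sum, so an unknown I can be forced to mark the
    cells of the word. *)
Lemma geometric_sum B L I : 1 < B ->
  (I * B.-1 + 1 = B ^ L) <-> I = \sum_(p < L) B ^ p.
Proof.
move=> B1; have := predn_exp B L; have : 0 < B ^ L by rewrite expn_gt0; lia.
set S := \sum_(_ < _) _ => BL eq_S; split=> [eq_I|->].
  have : B.-1 * I = B.-1 * S by lia.
  by move/eqP; rewrite eqn_pmul2l ?(eqP _); [move/eqP|lia].
by rewrite mulnC -eq_S addn1 prednK.
Qed.

(** The entries become digits in base [Big]; if they are small enough, the parity of one binomial
    coefficient tests all pairs at once. *)
Definition stack (Big : nat) (l : seq nat) := foldr (fun a b => a + Big * b) 0 l.

Lemma odd_bin_stack (k : nat) (l : seq (nat * nat)) :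
  all (fun ab => (ab.1 < 2 ^ k) && (ab.2 < 2 ^ k)) l ->
  odd 'C(stack (2 ^ k) (map snd l), stack (2 ^ k) (map fst l)) =
  all (fun ab => odd 'C(ab.2, ab.1)) l.
Proof.
elim: l => [|[a b] l IHl] //= /andP[/andP[lta ltb]] /IHl <-.
exact: odd_bin_split.
Qed.

(* Adding 2^e - 1 to a count c <= 2^e sets the bit of weight 2^e iff c > 0. *)
Lemma odd_bin_count e c : c <= 2 ^ e -> odd 'C(c + (2 ^ e).-1, 2 ^ e) = (0 < c).
Proof.
have e0 : 0 < 2 ^ e by rewrite expn_gt0.
case: c => [|c] lt_c; first by rewrite add0n bin_small // prednK.
rewrite addSnnS prednK //.
have := @odd_bin_split e 0 1 c 1 e0 lt_c.
by rewrite !muln1 add0n => ->; rewrite bin0 binn.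
Qed.

(** * Tilings and masking relations *)

Definition offset (n : nat) (o : 'I_4) := nth 0 [:: 0; 1; n; n.+1] o.

Definition window (T : finType) (x : T -> nat -> bool) (n p : nat) :
    {ffun T * 'I_4 -> bool} :=
  [ffun b => x b.1 (p + offset n b.2)].

(* Row t of the tiling occupies the cells t * n, ..., t * n + n - 1. *)
Definition tiling (T : finType) (phi : pred {ffun T * 'I_4 -> bool})
    (ts tu tg ti : T) (a n' N : nat) (x : T -> nat -> bool) :=
  let n := n' + a + 1 in
  [/\ x ts 0, x tu (n' + a), x tg N, x ti (N + a)
    & forall p, p < N + n + 2 -> phi (window x n p)].

Section Encoding.

Variables (T : finType) (phi : pred {ffun T * 'I_4 -> bool}) (ts tu tg ti : T).

(** Here e is the number of bits in a window. A count of at most e differences plus [2 ^ e - 1]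
    stays below [B = 2 ^ e.+1], so counting differences digit by digit never carries. *)
Let M := #|T|.
Let e := #|{: T * 'I_4}|.
Let B := 2 ^ e.+1.

Let M_gt0 : 0 < M. Proof. by apply/card_gt0P; exists ts. Qed.
Let B_gt1 : 1 < B. Proof. by rewrite -(expn0 2) ltn_exp2l. Qed.
Let B_gt0 : 0 < B. Proof. exact: ltnW. Qed.
Let bit_lt (b : bool) : b < B. Proof. by case: b. Qed.

Definition cell_digit (j : T) (p : nat) := p * M + enum_rank j.

Definition row_shift (n : nat) (o : 'I_4) := nth 0 [:: n.+1; n; 1; 0] o.

Lemma row_shift_offset n o : row_shift n o + offset n o = n.+1.
Proof. by case: o => [[|[|[|[|o]]]]] // ?; rewrite /row_shift /offset /=; lia. Qed.

(** Each cell takes M consecutive digits, one per track. The shift is chosen so that bit b of the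
    window at p lands on digit [(n + 2) M + p M], whatever b is. *)
Definition bit_shift n (b : T * 'I_4) := row_shift n b.2 * M + (M - enum_rank b.1).

Definition clause_lhs (n I : nat) := 2 ^ e * (B ^ (n.+2 * M) * I).

(* Its digit (n + 2) M + p M in base B is 2^e - 1 plus the number of bits in which
   the window at p differs from rho; this has bit e iff the number is positive. *)
Definition clause_rhs (n I W V : nat) (rho : {ffun T * 'I_4 -> bool}) :=
  \sum_b B ^ bit_shift n b * (if rho b then V else W)
  + (2 ^ e).-1 * (B ^ (n.+2 * M) * I).

(** For the intended I this has 2LM digits, all equal to 1. Twice the L cells are covered because a
    window at [p < L] reaches up to cell p + n + 1. *)
Definition all_ones (L I : nat) :=
  (\sum_(j < M) B ^ j) * I * (1 + (B ^ M) ^ L).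

(** The first pair forces the base-B digits of W to be 0 or 1, the next four test the prescribed
    cells, and each remaining pair excludes one forbidden window. *)
Definition masks (a n' N I W V : nat) : seq (nat * nat) :=
  let n := n' + a + 1 in let L := N + n + 2 in
  [:: (W, all_ones L I), (B ^ cell_digit ts 0, W),
      (B ^ cell_digit tu (n' + a), W), (B ^ cell_digit tg N, W),
      (B ^ cell_digit ti (N + a), W)
    & [seq (clause_lhs n I, clause_rhs n I W V rho) |
        rho <- enum {: {ffun T * 'I_4 -> bool}} & ~~ phi rho]].

(** Room for words of 2LM digits after the largest shift, which is [(n + 2) M]. *)
Definition width (n L : nat) := 2 * (L * M) + n.+2 * M.

Definition cell_mark (L d : nat) : nat := \sum_(p < L) (d == p * M).

Lemma cell_mark_val L H : L * M <= H ->
  digits_val B H (cell_mark L) = \sum_(p < L) (B ^ M) ^ p.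
Proof.
move=> le_H; rewrite digits_val_sum; apply: eq_bigr => p _.
rewrite -expnM [M * p]mulnC digits_val1 //.
by apply: leq_trans le_H; rewrite ltn_mul2r M_gt0 ltn_ord.
Qed.

Lemma cell_mark1 L p : p < L -> cell_mark L (p * M) = 1.
Proof.
move=> lt_p; rewrite /cell_mark (bigD1 (Ordinal lt_p)) //= eqxx big1 // => i.
by rewrite -val_eqE /= eqn_pmul2r // eq_sym => /negPf->.
Qed.

Lemma cell_markP L d : cell_mark L d = 0 \/ exists2 p, p < L & d = p * M.
Proof.
case: (pickP (fun p : 'I_L => d == p * M)) => [p /eqP->|no].
  by right; exists p.
by left; rewrite /cell_mark big1 // => p _; rewrite no.
Qed.

Lemma cell_mark_le1 L d : cell_mark L d <= 1.
Proof. by have [->|[p lt_p ->]] := cell_markP L d; rewrite ?cell_mark1. Qed.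

Lemma all_ones_val L I H : 2 * (L * M) <= H -> I = \sum_(p < L) (B ^ M) ^ p ->
  all_ones L I = digits_val B H (fun d => d < 2 * (L * M)).
Proof.
move=> le_H ->; rewrite /all_ones.
rewrite (digits_val_widen B le_H) => [|d le_d]; last by rewrite ltnNge le_d.
have -> : digits_val B (2 * (L * M)) (fun d => d < 2 * (L * M)) =
    \sum_(d < 2 * (L * M)) B ^ d.
  by apply: eq_bigr => d _; rewrite ltn_ord mul1n.
have pB : 0 < B.-1 by lia.
(* Multiplied by [B - 1], the three geometric sums telescope one after the other. *)
apply/eqP; rewrite -(eqn_pmul2l pB) !mulnA -predn_exp -predn_exp -predn_exp.
rewrite mulnC -expnM [M * L]mulnC.
have : 0 < B ^ (L * M) by rewrite expn_gt0 B_gt0.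
rewrite mul2n -addnn [(L + L) * M]mulnDl expnD; set z := B ^ (L * M) => z0.
by case: z z0 => [//|y] _; apply/eqP; nia.
Qed.

Lemma clause_rhs_val n L I W V (c : bool -> nat -> bool) rho :
  I = \sum_(p < L) (B ^ M) ^ p ->
  (forall s d, 2 * (L * M) <= d -> c s d = false) ->
  W = digits_val B (width n L) (c false) ->
  V = digits_val B (width n L) (c true) ->
  clause_rhs n I W V rho = digits_val B (width n L) (fun d =>
    \sum_b (bit_shift n b <= d) * c (rho b) (d - bit_shift n b)
    + (2 ^ e).-1 * ((n.+2 * M <= d) * cell_mark L (d - n.+2 * M))).
Proof.
move=> eI c0 eW eV; rewrite digits_valD digits_val_sum digits_valM.
rewrite /clause_rhs; congr (_ + _ * _).
  apply: eq_bigr => b _.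
  have -> : (if rho b then V else W) = digits_val B (width n L) (c (rho b)).
    by case: (rho b).
  rewrite digits_val_shift // => d le_d; rewrite c0 //; move: le_d; rewrite /width /bit_shift.
  have : row_shift n b.2 * M <= n.+1 * M.
    by rewrite leq_mul2r -(row_shift_offset n b.2) leq_addr orbT.
  rewrite (mulSn n.+1); move: (_ * M) (n.+1 * M) (L * M) (_ - _) (leq_subr (enum_rank b.1) M).
  by move=> *; lia.
rewrite -(@digits_val_shift _ _ _ (cell_mark L)) => [|d le_d].
  by rewrite cell_mark_val -?eI // /width; lia.
have [->|[p lt_p ed]] // := cell_markP L d.
have: p * M < L * M by rewrite ltn_mul2r M_gt0.
by move: le_d; rewrite /width ed; move: (p * M) (L * M) (n.+2 * M) => *; lia.
Qed.

Lemma clause_lhs_val n L I : I = \sum_(p < L) (B ^ M) ^ p ->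
  clause_lhs n I = digits_val B (width n L) (fun d =>
    2 ^ e * ((n.+2 * M <= d) * cell_mark L (d - n.+2 * M))).
Proof.
move=> eI; rewrite digits_valM -(@digits_val_shift _ _ _ (cell_mark L)) => [|d le_d].
  by rewrite cell_mark_val -?eI // /width; lia.
have [->|[p lt_p ed]] // := cell_markP L d.
have: p * M < L * M by rewrite ltn_mul2r M_gt0.
by move: le_d; rewrite /width ed; move: (p * M) (L * M) (n.+2 * M) => *; lia.
Qed.

Lemma clause_lhs_lt n L I : I = \sum_(p < L) (B ^ M) ^ p ->
  clause_lhs n I < 2 ^ (e.+1 * width n L).
Proof.
move=> eI; rewrite (clause_lhs_val n eI) expnM; apply: digits_val_lt => d.
apply: (@leq_ltn_trans (2 ^ e)); last by rewrite /B ltn_exp2l.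
rewrite -[X in _ <= X]muln1 leq_mul2l; apply/orP; right.
by case: (_ <= d) => /=; rewrite ?mul0n ?mul1n ?cell_mark_le1.
Qed.

(** W and V are not yet known to have digits 0 and 1, so both are first replaced by their sum
    [all_ones L I], whose digits are known. *)
Lemma clause_rhs_lt n L I W V rho : I = \sum_(p < L) (B ^ M) ^ p ->
  W + V = all_ones L I -> clause_rhs n I W V rho < 2 ^ (e.+1 * width n L).
Proof.
move=> eI eWV; set P := all_ones L I.
apply: (@leq_ltn_trans (clause_rhs n I P P rho)).
  rewrite leq_add2r; apply: leq_sum => b _; rewrite leq_mul2l; apply/orP; right.
  by rewrite /P -eWV; case: (rho b); rewrite ?leq_addl ?leq_addr.
have eP : P = digits_val B (width n L) (fun d => d < 2 * (L * M)).
  by apply: all_ones_val => //; apply: leq_addr.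
rewrite (@clause_rhs_val n L I P P (fun _ d => d < 2 * (L * M))) //; last first.
  by move=> _ d le_d; rewrite ltnNge le_d.
rewrite expnM; apply: digits_val_lt => d.
rewrite /B expnS [2 * 2 ^ e]mul2n -[(2 ^ e).*2]addnn -addnS; apply: leq_add.
  apply: (@leq_trans e); last exact: ltnW (ltn_expl _ _).
  rewrite -[X in _ <= X]sum1_card; apply: leq_sum => b _.
  by case: (bit_shift n b <= d); case: (d - _ < _).
rewrite -[X in _ < X](@prednK (2 ^ e)) ?expn_gt0 // ltnS.
rewrite -[X in _ <= X]muln1 leq_mul2l; apply/orP; right.
by case: (n.+2 * M <= d) => /=; rewrite ?mul0n ?mul1n ?cell_mark_le1.
Qed.

(** At digit [(n + 2) M + p M] the left side has only bit e, and the right side has that bit iff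
    some difference from [rho] was counted. At all other digits the left side is 0 and masks
    nothing. The bound [n < L] keeps windows within the 2L cells. *)
Lemma clause_maskP n L I W V (w : nat -> bool) rho :
  n < L -> I = \sum_(p < L) (B ^ M) ^ p ->
  (forall d, 2 * (L * M) <= d -> w d = false) ->
  W = digits_val B (width n L) w ->
  V = digits_val B (width n L) (fun d => (d < 2 * (L * M)) && ~~ w d) ->
  odd 'C(clause_rhs n I W V rho, clause_lhs n I) <->
  forall p, p < L -> window (fun j p => w (cell_digit j p)) n p <> rho.
Proof.
move=> lt_nL eI w0 eW eV.
set c := fun s d => if s then (d < 2 * (L * M)) && ~~ w d else w d.
rewrite (@clause_rhs_val n L I W V c) //; last first.
  by case=> d le_d /=; rewrite ?w0 // ltnNge le_d.
rewrite (clause_lhs_val n eI).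
set count := fun d => \sum_b (bit_shift n b <= d) * c (rho b) (d - bit_shift n b).
have count_le d : count d <= 2 ^ e.
  apply: (@leq_trans e); last exact: ltnW (ltn_expl _ _).
  rewrite -[X in _ <= X]sum1_card; apply: leq_sum => b _.
  by case: (bit_shift n b <= d); case: (c _ _).
have mark_le d : (n.+2 * M <= d) * cell_mark L (d - n.+2 * M) <= 1.
  by case: (n.+2 * M <= d) => /=; rewrite ?mul0n ?mul1n ?cell_mark_le1.
have e_gt0 : 0 < 2 ^ e by rewrite expn_gt0.
have B2 : B = 2 ^ e + 2 ^ e by rewrite /B expnS mul2n addnn.
have countE p : p < L -> (0 < count (n.+2 * M + p * M)) =
    (window (fun j p => w (cell_digit j p)) n p != rho).
  move=> lt_p.
  (* The complement is read where [rho b] is true and the word itself where it is false, so the term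
     is 1 exactly at a difference. *)
  have litE b : (bit_shift n b <= n.+2 * M + p * M) *
      c (rho b) (n.+2 * M + p * M - bit_shift n b) =
      (window (fun j p => w (cell_digit j p)) n p b != rho b).
    have eq_d : n.+2 * M + p * M =
        bit_shift n b + cell_digit b.1 (p + offset n b.2).
      rewrite /bit_shift /cell_digit.
      have := ltn_ord (enum_rank b.1); rewrite -/M.
      have := row_shift_offset n b.2.
      move: (row_shift _ _) (offset _ _) (nat_of_ord _) => r o i ero lti.
      have -> : n.+2 = r + o + 1 by lia.
      by rewrite !mulnDl mul1n; lia.
    rewrite eq_d leq_addr mul1n addKn ffunE /c.
    set d := cell_digit _ _.
    have lt_d : d < 2 * (L * M).
      rewrite /d /cell_digit.
      have : offset n b.2 <= n.+1 by rewrite -(row_shift_offset n b.2) leq_addl.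
      have := ltn_ord (enum_rank b.1); rewrite -/M => lti le_o.
      apply: (@leq_trans ((p + offset n b.2).+1 * M)); first by rewrite mulSn; lia.
      by rewrite mulnA leq_mul2r; apply/orP; right; lia.
    by rewrite lt_d; case: (rho b); case: (w d).
  rewrite /count (eq_bigr _ (fun b _ => litE b)) lt0n sum_nat_eq0 negb_forall.
  apply/existsP/idP => [[b]|ne].
    by rewrite /= eqb0 negbK; apply: contraNneq => ->.
  apply/existsP; rewrite -[[exists _, _]]negbK negb_exists.
  apply: contraNN ne => /forallP eq_b; apply/eqP/ffunP => b.
  by have := eq_b b; rewrite /= eqb0 negbK negbK => /eqP.
rewrite odd_bin_digits; first last.
- move=> d; rewrite -/(count d).
  have := count_le d; have := mark_le d; move: (_ * cell_mark _ _) => k le_k le_c.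
  rewrite -/B B2; case: k le_k => [|[|]] // _; rewrite ?muln0 ?muln1; lia.
- move=> d; have := mark_le d; move: (_ * cell_mark _ _) => k le_k.
  by rewrite -/B B2; case: k le_k => [|[|]] // _; rewrite ?muln0 ?muln1; lia.
split=> [all_odd p lt_p|ne_rho d lt_d].
  apply/eqP; rewrite -countE //.
  have := all_odd (n.+2 * M + p * M); rewrite -/(count _).
  rewrite leq_addr mul1n addKn cell_mark1 // !muln1 odd_bin_count //; apply.
  have : p * M < L * M by rewrite ltn_mul2r M_gt0.
  by rewrite /width; lia.
rewrite -/(count d); case: (leqP (n.+2 * M) d) => [le_d|_]; last first.
  by rewrite mul0n !muln0 bin0.
rewrite mul1n; have [->|[p lt_p ed]] := cell_markP L (d - n.+2 * M).
  by rewrite !muln0 bin0.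
rewrite ed cell_mark1 // !muln1 odd_bin_count //.
have -> : d = n.+2 * M + p * M by lia.
by rewrite countE //; apply/eqP; apply: ne_rho.
Qed.

Lemma cell_digit_lt j p L : p < L -> cell_digit j p < L * M.
Proof.
move=> lt_p; apply: (@leq_trans (p.+1 * M)); last by rewrite leq_mul2r lt_p orbT.
by rewrite mulSn /cell_digit [M + _]addnC ltn_add2l ltn_ord.
Qed.

Lemma bit_maskP H c (w : nat -> bool) : c < H ->
  odd 'C(digits_val B H w, B ^ c) <-> w c.
Proof.
move=> lt_c; rewrite -(digits_val1 B lt_c) odd_bin_digits.
- split=> [/(_ c lt_c)|w_c d _]; first by rewrite eqxx bin1; case: (w c).
  by case: eqP => [->|_]; rewrite ?bin0 // w_c binn.
- by move=> d; apply: bit_lt.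
- by move=> d; apply: bit_lt.
Qed.

Lemma masks_lt a n' N I W V (n := n' + a + 1) (L := N + n + 2) :
  I = \sum_(p < L) (B ^ M) ^ p -> W + V = all_ones L I ->
  all (fun ab => (ab.1 < 2 ^ (e.+1 * width n L)) &&
                 (ab.2 < 2 ^ (e.+1 * width n L))) (masks a n' N I W V).
Proof.
move=> eI eWV; set H := width n L.
have P_lt : all_ones L I < 2 ^ (e.+1 * H).
  rewrite (@all_ones_val L I H) ?leq_addr // expnM; apply: digits_val_lt => d.
  exact: bit_lt.
have W_lt : W < 2 ^ (e.+1 * H) by apply: leq_ltn_trans P_lt; rewrite -eWV leq_addr.
have cell_lt j p : p < L -> B ^ cell_digit j p < 2 ^ (e.+1 * H).
  move=> lt_p; rewrite expnM ltn_exp2l //; have := cell_digit_lt j lt_p.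
  by rewrite /H /width; move: (L * M) (_ * M) (cell_digit _ _) => *; lia.
rewrite /= -/n -/L P_lt W_lt !cell_lt ?(andbT, andTb); try by rewrite /L /n; lia.
apply/allP => _ /mapP[rho _ ->] /=.
by rewrite clause_rhs_lt // clause_lhs_lt.
Qed.

Definition tiling_eqs a n' N I W V (n := n' + a + 1) (L := N + n + 2) :=
  [/\ I * (B ^ M).-1 + 1 = (B ^ M) ^ L, W + V = all_ones L I
    & odd 'C(stack (2 ^ (e.+1 * width n L)) (map snd (masks a n' N I W V)),
             stack (2 ^ (e.+1 * width n L)) (map fst (masks a n' N I W V)))].

Lemma clause_masksP n L I W V (w : nat -> bool) :
  n < L -> I = \sum_(p < L) (B ^ M) ^ p ->
  (forall d, 2 * (L * M) <= d -> w d = false) ->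
  W = digits_val B (width n L) w ->
  V = digits_val B (width n L) (fun d => (d < 2 * (L * M)) && ~~ w d) ->
  all (fun ab => odd 'C(ab.2, ab.1))
    [seq (clause_lhs n I, clause_rhs n I W V rho) |
        rho <- enum {: {ffun T * 'I_4 -> bool}} & ~~ phi rho] <->
  forall p, p < L -> phi (window (fun j p => w (cell_digit j p)) n p).
Proof.
move=> lt_nL eI w0 eW eV; split=> [/allP all_odd p lt_p|all_phi].
  apply/negPn/negP => bad.
  set rho := window _ n p in bad.
  have : odd 'C(clause_rhs n I W V rho, clause_lhs n I).
    apply: (all_odd (_, _)); apply/mapP; exists rho => //.
    by rewrite mem_filter bad mem_enum.
  by move/(clause_maskP rho lt_nL eI w0 eW eV)/(_ p lt_p).
apply/allP => _ /mapP[rho + ->]; rewrite mem_filter => /andP[bad _] /=.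
apply/(clause_maskP rho lt_nL eI w0 eW eV) => p lt_p eq_rho.
by rewrite -eq_rho all_phi in bad.
Qed.

(** A tiling is cut to 2L cells and written in base B. Conversely the masks force W and V to be
    complementary words of digits 0 and 1, from which a tiling is read off. *)
Lemma tiling_eqsP a n' N :
  (exists x, tiling phi ts tu tg ti a n' N x) <->
  exists I W V, tiling_eqs a n' N I W V.
Proof.
set n := n' + a + 1; set L := N + n + 2; set Q := 2 * (L * M).
have BM_gt1 : 1 < B ^ M by rewrite -(expn0 B) ltn_exp2l.
have lt_nL : n < L by rewrite /L; lia.
have cell_width j p : p < L -> cell_digit j p < width n L.
  move=> /(cell_digit_lt j); rewrite /width.
  by move: (L * M) (_ * M) (cell_digit _ _) => *; lia.
have digit_lt (f : nat -> bool) d : f d < 2 ^ e.+1.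
  exact: bit_lt.
have full I : I = \sum_(p < L) (B ^ M) ^ p ->
    all_ones L I = digits_val B (width n L) (fun d => d < Q).
  by apply: all_ones_val; apply: leq_addr.
split=> [[x [x_s x_u x_g x_i x_phi]]|[I [W [V [/(geometric_sum _ _ BM_gt1) eI eWV]]]]].
  pose w d := (d < Q) && x (nth ts (enum T) (d %% M)) (d %/ M).
  pose I := \sum_(p < L) (B ^ M) ^ p.
  pose W := digits_val B (width n L) w.
  pose V := digits_val B (width n L) (fun d => (d < Q) && ~~ w d).
  have w0 d : Q <= d -> w d = false by rewrite /w ltnNge => ->.
  have wE j p : p < L + L -> w (cell_digit j p) = x j p.
    move=> /(cell_digit_lt j); rewrite addnn -mul2n -mulnA -/Q => lt_Q.
    rewrite /w lt_Q /cell_digit modnMDl modn_small ?ltn_ord // divnMDl //.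
    by rewrite divn_small ?ltn_ord // addn0 nth_enum_rank.
  have eWV : W + V = all_ones L I.
    rewrite full // -digits_valD; apply: digits_val_ext => d _.
    by rewrite /w; case: (_ < Q) => //=; case: (x _ _).
  exists I, W, V; split=> //; first exact/geometric_sum.
  rewrite odd_bin_stack; last exact: masks_lt.
  have bit_mask j p : p < L -> x j p -> odd 'C(W, B ^ cell_digit j p).
    by move=> lt_p x_p; apply/bit_maskP; [exact: cell_width | rewrite wE //; lia].
  rewrite /= -/n -/L !bit_mask ?andTb; try by rewrite // /L /n; lia.
  apply/andP; split.
    rewrite full //; apply/odd_bin_digits => // d _.
    by rewrite /w; case: (_ < Q) => //=; case: (x _ _).
  apply/(clause_masksP lt_nL _ w0) => // p lt_p.
  suff -> : window (fun j p => w (cell_digit j p)) n p = window x n p by exact: x_phi.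
  apply/ffunP => b; rewrite !ffunE wE //.
  by have := row_shift_offset n b.2; lia.
rewrite odd_bin_stack ?masks_lt //.
move=> /and5P[mask_W mask_s mask_u mask_g /andP[mask_i mask_phi]].
have W_lt : W < B ^ width n L.
  apply: (@leq_ltn_trans (all_ones L I)); first by rewrite -eWV leq_addr.
  by rewrite full //; apply: digits_val_lt => d; apply: digit_lt.
have eW0 := digits_val_divn B_gt0 W_lt.
(* Such a coefficient is odd only if the digit is at most 1, and is 0 from position Q on. *)
have W_bit d : d < width n L -> odd 'C(d < Q, W %/ B ^ d %% B).
  move: mask_W; rewrite /= -/L full // {1}eW0 => /odd_bin_digits; apply=> // i.
  by rewrite ltn_mod.
pose w d := (d < Q) && (W %/ B ^ d %% B != 0).
have w0 d : Q <= d -> w d = false by rewrite /w ltnNge => ->.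
have eW : W = digits_val B (width n L) w.
  rewrite [LHS]eW0; apply: digits_val_ext => d /W_bit; rewrite /w.
  by case: (_ %% _) => [|[|k]]; case: (_ < Q) => //=; rewrite bin_small.
(* Cancelling W in [W + V = all_ones L I] leaves the complementary digits for V. *)
have eV : V = digits_val B (width n L) (fun d => (d < Q) && ~~ w d).
  apply: (@addnI W); rewrite eWV full // {1}eW -digits_valD.
  apply: digits_val_ext => d _; rewrite /w.
  by case: (_ < Q) => //=; case: (_ != _).
have bit_w j p : p < L -> odd 'C(W, B ^ cell_digit j p) -> w (cell_digit j p).
  by move=> lt_p; rewrite eW => /bit_maskP; apply; apply: cell_width.
exists (fun j p => w (cell_digit j p)); split.
1-4: by apply: bit_w => //; rewrite /L /n; lia.
exact/(clause_masksP lt_nL eI w0 eW eV).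
Qed.

End Encoding.

(** * Natural exponential equations in nine variables *)

Fixpoint neval (n : nat) (v : 'I_n -> nat) (e : expr n) : nat :=
  match e with
  | Var i => v i
  | Cst k => k
  | Add e1 e2 => neval v e1 + neval v e2
  | Mul e1 e2 => neval v e1 * neval v e2
  | Pow e1 e2 => neval v e1 ^ neval v e2
  end.

Definition expressible (n : nat) (f : ('I_n -> nat) -> nat) :=
  exists e, forall v, neval v e = f v.

Section Expressible.

Variable n : nat.
Implicit Types f g : ('I_n -> nat) -> nat.

Lemma expressible_ext f g : f =1 g -> expressible f -> expressible g.
Proof. by move=> eq_fg [d df]; exists d => v; rewrite df. Qed.

Lemma expressible_var (i : 'I_n) : expressible (fun v => v i).
Proof. by exists (Var i). Qed.

Lemma expressible_cst c : @expressible n (fun=> c).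
Proof. by exists (Cst c). Qed.

Lemma expressibleD f g :
  expressible f -> expressible g -> expressible (fun v => f v + g v).
Proof. by move=> [d df] [e eg]; exists (Add d e) => v; rewrite /= df eg. Qed.

Lemma expressibleM f g :
  expressible f -> expressible g -> expressible (fun v => f v * g v).
Proof. by move=> [d df] [e eg]; exists (Mul d e) => v; rewrite /= df eg. Qed.

Lemma expressibleX f g :
  expressible f -> expressible g -> expressible (fun v => f v ^ g v).
Proof. by move=> [d df] [e eg]; exists (Pow d e) => v; rewrite /= df eg. Qed.

Lemma expressibleS f : expressible f -> expressible (fun v => (f v).+1).
Proof. by move=> [d df]; exists (Add d (Cst 1)) => v; rewrite /= df addn1. Qed.

Lemma expressible_sum (I : Type) (r : seq I) (F : I -> ('I_n -> nat) -> nat) :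
  (forall i, expressible (F i)) -> expressible (fun v => \sum_(i <- r) F i v).
Proof.
move=> exF; elim: r => [|i r [e ee]].
  by exists (Cst 0) => v; rewrite big_nil.
by have [d de] := exF i; exists (Add d e) => v; rewrite big_cons /= de ee.
Qed.

Lemma expressible_stack (I : Type) (r : seq I) f (F : I -> ('I_n -> nat) -> nat) :
  expressible f -> (forall i, expressible (F i)) ->
  expressible (fun v => stack (f v) [seq F i v | i <- r]).
Proof.
move=> ef exF; elim: r => [|i r exr]; first exact: expressible_cst.
exact: expressibleD (exF i) (expressibleM ef exr).
Qed.

End Expressible.

Ltac expressibility := repeat match goal with
  | H : expressible ?f |- expressible ?f => exact: H
  | H : expressible ?f |- expressible (fun v => ?f v) => exact: H
  | |- expressible (fun v => v ?i) => exact: expressible_var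
  | |- expressible (fun v => @?f v + @?g v) => apply: (@expressibleD _ f g)
  | |- expressible (fun v => @?f v * @?g v) => apply: (@expressibleM _ f g)
  | |- expressible (fun v => @?f v ^ @?g v) => apply: (@expressibleX _ f g)
  | |- expressible (fun v => ?c) => exact: expressible_cst
  | |- expressible (fun v => (@?f v).+1) => apply: (@expressibleS _ f)
  end.

Definition nat_solution (n : nat) (E : seq (expr n * expr n)) (v : 'I_n -> nat) :=
  all (fun lr => neval v lr.1 == neval v lr.2) E.

Section NineUnknowns.

Local Notation "'#' k" := (@Ordinal 9 k isT) (at level 0, k at level 0).

(** The nine variables are, in order, a, n', N, I, W, V and the m, r, s of [odd_bin_power]. Since T
    is fixed, there are finitely many forbidden windows and all masks are expressions. *)
Lemma tiling_exponential (T : finType) (phi : pred {ffun T * 'I_4 -> bool})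
    (ts tu tg ti : T) :
  exists E : seq (expr 9 * expr 9), forall a,
    (exists n' N x, tiling phi ts tu tg ti a n' N x) <->
    (exists2 v : 'I_9 -> nat, v ord0 = a & nat_solution E v).
Proof.
pose M := #|T|; pose e := #|{: T * 'I_4}|; pose B := 2 ^ e.+1.
pose n (v : 'I_9 -> nat) := v #1 + v #0 + 1.
pose L (v : 'I_9 -> nat) := v #2 + n v + 2.
pose Big v := 2 ^ (e.+1 * width T (n v) (L v)).
pose ms (v : 'I_9 -> nat) := masks phi ts tu tg ti (v #0) (v #1) (v #2) (v #3) (v #4) (v #5).
pose S v := stack (Big v) (map snd (ms v)).
pose R v := stack (Big v) (map fst (ms v)).
pose U v := 2 ^ (S v).+1.
have ex_n : expressible n by rewrite /n; expressibility.
have ex_L : expressible L by rewrite /L; expressibility.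
have ex_Big : expressible Big by rewrite /Big /width; expressibility.
have ex_ones : expressible (fun v => all_ones T (L v) (v #3)).
  by rewrite /all_ones; expressibility.
have ex_lhs : expressible (fun v => clause_lhs T (n v) (v #3)).
  by rewrite /clause_lhs; expressibility.
have ex_rhs rho : expressible (fun v => @clause_rhs T (n v) (v #3) (v #4) (v #5) rho).
  rewrite /clause_rhs; expressibility.
  apply: expressible_sum => b; rewrite /bit_shift.
  case: b => j [[|[|[|[|o]]]] //= lt_o]; rewrite /row_shift /=;
    case: (rho _); expressibility.
pose clauses := [seq rho <- enum {: {ffun T * 'I_4 -> bool}} | ~~ phi rho].
have ex_S : expressible S.
  rewrite /S /ms /masks /= /cell_digit; expressibility.
  apply: expressible_ext (expressible_stack clauses ex_Big ex_rhs) => v.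
  by rewrite -map_comp.
have ex_R : expressible R.
  rewrite /R /ms /masks /= /cell_digit; expressibility.
  apply: expressible_ext (expressible_stack clauses ex_Big (fun=> ex_lhs)) => v.
  by rewrite -map_comp.
have ex_U : expressible U by rewrite /U; expressibility.
have [l1 el1] : expressible (fun v => v #3 * (B ^ M).-1 + 1) by expressibility.
have [r1 er1] : expressible (fun v => (B ^ M) ^ L v) by expressibility.
have [l2 el2] : expressible (fun v => v #4 + v #5) by expressibility.
have [r2 er2] := ex_ones.
have [l3 el3] : expressible (fun v => (1 + U v) ^ S v) by expressibility.
have [r3 er3] : expressible (fun v => (2 * v #6 + 1) * U v ^ R v + v #7) by expressibility.
have [l4 el4] : expressible (fun v => v #7 + v #8 + 1) by expressibility.
have [r4 er4] : expressible (fun v => U v ^ R v) by expressibility.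
(* In order: the geometric sum, the complementarity of W and V, the division of [(1 + U) ^ S] with
   odd quotient, and the bound on its remainder. *)
exists [:: (l1, r1); (l2, r2); (l3, r3); (l4, r4)] => a.
split=> [[n' [N /tiling_eqsP[I [W [V [eI eWV]]]]]]|[v <-]].
  move=> /odd_bin_power[m [r [s [eS eR]]]].
  exists (fun i => nth 0 [:: a; n'; N; I; W; V; m; r; s] i) => //.
  rewrite /nat_solution /= el1 er1 el2 er2 el3 er3 el4 er4.
  by apply/and5P; split=> //; apply/eqP.
rewrite /nat_solution /= el1 er1 el2 er2 el3 er3 el4 er4.
move=> /and5P[/eqP e1 /eqP e2 /eqP e3 /eqP e4 _].
have -> : ord0 = #0 by apply: val_inj.
exists (v #1), (v #2); apply/tiling_eqsP; exists (v #3), (v #4), (v #5); split=> //.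
by apply/odd_bin_power; exists (v #6), (v #7), (v #8).
Qed.

End NineUnknowns.

(** * Counter programs *)

Definition regs := nat -> nat.

Definition upd (v : regs) i x : regs := fun k => if k == i then x else v k.

Inductive act := Zero of nat | Inc of nat | Same of nat & nat.

Definition step (c : act) (v w : regs) : Prop :=
  match c with
  | Zero i => w = upd v i 0
  | Inc i => w = upd v i (v i).+1
  | Same i j => v i = v j /\ w = v
  end.

Inductive star (T : Type) (R : T -> T -> Prop) (v : T) : T -> Prop :=
| star_refl : star R v v
| star_step u w : R v u -> star R u w -> star R v w.

(** Regular expressions without alternatives: all nondeterminism is in the number of rounds of a
    [Star], and wrong guesses are blocked by a [Same] test. *)
Inductive prog := Atom of act | Seq of prog & prog | Star of prog.

Fixpoint run (P : prog) : regs -> regs -> Prop :=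
  match P with
  | Atom c => step c
  | Seq P Q => fun v w => exists2 u, run P v u & run Q u w
  | Star P => star (run P)
  end.

Lemma star_snoc (T : Type) (R : T -> T -> Prop) v u w : star R v u -> R u w -> star R v w.
Proof.
elim=> [x Rxw|x y z Rxy _ IH /IH]; last exact: star_step.
by apply: star_step Rxw _; apply: star_refl.
Qed.

Lemma star_inv (T : Type) (R : T -> T -> Prop) (J : T -> Prop) v w :
  (forall u u', J u -> R u u' -> J u') -> J v -> star R v w -> J w.
Proof. by move=> JR Jv rw; elim: rw Jv => // x y z Rxy _ IH /JR/(_ Rxy)/IH. Qed.

Lemma updE v i x : upd v i x i = x. Proof. by rewrite /upd eqxx. Qed.

Lemma upd_neq v i x k : k != i -> upd v i x k = v k.
Proof. by rewrite /upd => /negPf->. Qed.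

Lemma upd_upd v i x y : upd (upd v i x) i y = upd v i y.
Proof. by apply/funext => k; rewrite /upd; case: eqP. Qed.

Lemma upd_id v i : upd v i (v i) = v.
Proof. by apply/funext => k; rewrite /upd; case: eqP => [->|]. Qed.

Lemma run_star_inc i v w :
  run (Star (Atom (Inc i))) v w <-> exists c, w = upd v i (v i + c).
Proof.
split=> [|[c ->]].
  elim=> [u|x y z /= -> _ [c ->]]; first by exists 0; rewrite addn0 upd_id.
  by exists c.+1; rewrite upd_upd updE addSnnS.
elim: c => [|c IHc]; first by rewrite addn0 upd_id; apply: star_refl.
by apply: star_snoc IHc _; rewrite /= upd_upd updE addnS.
Qed.

(** Assignment by guessing: register i is reset, incremented an arbitrary number of times, and then
    compared. *)
Definition copy i j := Seq (Atom (Zero i)) (Seq (Star (Atom (Inc i))) (Atom (Same i j))).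

Lemma run_copy i j v w : i != j -> run (copy i j) v w <-> w = upd v i (v j).
Proof.
move=> ne_ij; have ne_ji : j != i by rewrite eq_sym.
split=> [[_ -> [u /run_star_inc[c ->]]]|->].
  by case; rewrite upd_upd !updE upd_neq // => -> ->.
exists (upd v i 0) => //; exists (upd v i (v j)).
  by apply/run_star_inc; exists (v j); rewrite upd_upd updE.
by rewrite /= updE upd_neq.
Qed.

Definition test_pos q z := Seq (Atom (Zero q)) (Seq (Atom (Inc q))
  (Seq (Star (Atom (Inc q))) (Atom (Same q z)))).

Lemma run_test_pos q z v w : q != z ->
  run (test_pos q z) v w <-> 0 < v z /\ w = upd v q (v z).
Proof.
move=> ne_qz; have ne_zq : z != q by rewrite eq_sym.
split=> [[_ -> [_ -> [u /run_star_inc[c ->]]]]|[z_gt0 ->]].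
  by case; rewrite !upd_upd !updE upd_neq // add1n => <- ->.
exists (upd v q 0) => //; exists (upd v q 1); first by rewrite /= upd_upd updE.
exists (upd v q (v z)); last by rewrite /= updE upd_neq.
by apply/run_star_inc; exists (v z).-1; rewrite upd_upd updE add1n prednK.
Qed.

Definition test_zero q z := Seq (Atom (Zero q)) (Atom (Same z q)).

Lemma run_test_zero q z v w : q != z ->
  run (test_zero q z) v w <-> v z = 0 /\ w = upd v q 0.
Proof.
move=> ne_qz; have ne_zq : z != q by rewrite eq_sym.
split=> [[_ ->]|[z0 ->]]; first by case; rewrite upd_neq // updE.
by exists (upd v q 0) => //=; rewrite updE upd_neq.
Qed.

(** Registers from b on are scratch; those below b, except [out], survive. As programs guess,
    soundness concerns every finished run, while completeness asks for one run per value. *)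
Definition implements n (f : recfun n) (args : n.-tuple nat) (out b : nat) (P : prog) :=
  (forall v w, run P v w ->
     rec_value f (map_tuple v args) (w out) /\
     forall k, k < b -> k != out -> w k = v k) /\
  (forall v y, rec_value f (map_tuple v args) y ->
     exists2 w, run P v w & w out = y).

Lemma map_tuple_regs n (args : n.-tuple nat) (v w : regs) :
  {in args, v =1 w} -> map_tuple v args = map_tuple w args.
Proof. by move=> eq_vw; apply: val_inj; apply/eq_in_map. Qed.

(** The m intermediate values go to registers b, ..., b + m - 1, and the scratch area starts after
    them. *)
Lemma implements_comp m n (f : recfun m) (g : 'I_m -> recfun n)
    (args : n.-tuple nat) out b (Pf : prog) (Pg : 'I_m -> prog) :
  all (fun r => r < b) args -> out < b -> out \notin args ->
  (forall i, implements (g i) args (b + i) (b + m) (Pg i)) ->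
  implements f [tuple b + i | i < m] out (b + m) Pf ->
  exists P, implements (RComp f g) args out b P.
Proof.
move=> /allP args_lt out_lt out_args impl_g [f_sound f_complete].
have args_frame (v w : regs) : (forall k, k < b -> w k = v k) ->
    map_tuple w args = map_tuple v args.
  by move=> fr; apply: map_tuple_regs => r /args_lt/fr.
have [Q [Q_sound Q_complete]] : exists Q,
   (forall v w, run Q v w ->
      (forall i, rec_value (g i) (map_tuple v args) (w (b + i))) /\
      forall k, k < b -> w k = v k) /\
   (forall v (ys : 'I_m -> nat),
      (forall i, rec_value (g i) (map_tuple v args) (ys i)) ->
      exists2 w, run Q v w & forall i : 'I_m, w (b + i) = ys i).
  (* Generalized from [enum 'I_m] to its tails for the induction; a value already written survives
     because its register is not an output of the later programs. *)
  suff [Q [Q_sound Q_complete]] : exists Q,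
   (forall v w, run Q v w ->
      {in enum 'I_m, forall i, rec_value (g i) (map_tuple v args) (w (b + i))} /\
      forall k, k < b + m -> k \notin [seq b + nat_of_ord i | i <- enum 'I_m] -> w k = v k) /\
   (forall v (ys : 'I_m -> nat),
      {in enum 'I_m, forall i, rec_value (g i) (map_tuple v args) (ys i)} ->
      exists2 w, run Q v w & {in enum 'I_m, forall i : 'I_m, w (b + i) = ys i}).
    exists Q; split=> [v w /Q_sound[gw fr]|v ys gy].
      split=> [i|k lt_k]; first by apply: gw; rewrite mem_enum.
      apply: fr; first by rewrite ltn_addr.
      by apply/mapP => -[i _ ek]; rewrite ek ltnNge leq_addr in lt_k.
    have [|w rw wE] := Q_complete v ys; first by move=> i _; apply: gy.
    by exists w => // i; apply: wE; rewrite mem_enum.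
  elim: (enum 'I_m) (enum_uniq 'I_m) => [_|i l IHl /= /andP[i_l uniq_l]].
    exists (Atom (Same 0 0)); split=> [v w [_ ->]|v ys _]; first by split.
    by exists v.
  have [Q [Q_sound Q_complete]] := IHl uniq_l.
  have [g_sound g_complete] := impl_g i.
  have bi_l : b + i \notin [seq b + nat_of_ord i | i <- l].
    by rewrite (mem_map (f := fun i : 'I_m => b + i)) // => x y /addnI/val_inj.
  have lt_bi (j : 'I_m) : b + j < b + m by rewrite ltn_add2l.
  have ne_b (j : 'I_m) k : k < b -> k != b + j by move=> lt_k; lia.
  exists (Seq (Pg i) Q); split=> [v w [u /g_sound[gu fru] /Q_sound[gw frw]]|v ys gy].
    have eq_args : map_tuple u args = map_tuple v args.
      by apply: args_frame => k lt_k; apply: fru; [rewrite ltn_addr | exact: ne_b].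
    split=> [j|k lt_k]; last first.
      by rewrite inE negb_or => /andP[ne_k k_l]; rewrite frw // fru.
    rewrite inE => /predU1P[->|j_l]; first by rewrite frw.
    by rewrite -eq_args; apply: gw.
  have [|u ru ui] := g_complete v (ys i); first by apply: gy; rewrite mem_head.
  have [gu fru] := g_sound _ _ ru.
  have eq_args : map_tuple u args = map_tuple v args.
    by apply: args_frame => k lt_k; apply: fru; [rewrite ltn_addr | exact: ne_b].
  have [|w rw wE] := Q_complete u ys.
    by move=> j j_l; rewrite eq_args; apply: gy; rewrite inE j_l orbT.
  have [_ frw] := Q_sound _ _ rw.
  exists w => [|j]; first by exists u.
  rewrite inE => /predU1P[->|]; last exact: wE.
  by rewrite frw.
have tupE (u : regs) (ys : m.-tuple nat) : (forall i : 'I_m, u (b + i) = tnth ys i) ->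
    map_tuple u [tuple b + i | i < m] = ys.
  by move=> uE; apply: eq_from_tnth => i; rewrite tnth_map tnth_mktuple.
exists (Seq Q Pf); split=> [v w [u /Q_sound[gu fru] /f_sound[fw frw]]|v y /= [ys [gy fy]]].
  split=> [|k lt_k ne_k]; last by rewrite frw ?fru // ltn_addr.
  exists [tuple u (b + i) | i < m]; split=> [i|]; first by rewrite tnth_mktuple.
  by rewrite -(tupE u [tuple u (b + i) | i < m]) // => i; rewrite tnth_mktuple.
have [u ru uE] := Q_complete v _ gy.
have [|w rw wy] := f_complete u y; first by rewrite (tupE _ ys uE).
by exists w => //; exists u.
Qed.

(** Register b holds the current value, b + 1 the counter, and b + 2 the result of g before it is
    copied back. The loop stops at a guessed time, checked by comparing the counter with the
    recursion argument. *)
Lemma implements_prec n (f : recfun n) (g : recfun n.+2) (args : n.+1.-tuple nat)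
    out b (Pf Pg : prog) :
  all (fun r => r < b) args -> out < b -> out \notin args ->
  implements f [tuple of behead args] b b.+3 Pf ->
  implements g [tuple of [:: b.+1, b & behead args]] b.+2 b.+3 Pg ->
  exists P, implements (RPrec f g) args out b P.
Proof.
move=> /allP args_lt out_lt out_args [f_sound f_complete] [g_sound g_complete].
set rest := [tuple of behead args] in f_sound f_complete.
have rest_frame (v w : regs) : (forall k, k < b -> w k = v k) ->
    map_tuple w rest = map_tuple v rest.
  by move=> fr; apply: map_tuple_regs => r /mem_behead/args_lt/fr.
have theadE (v : regs) : thead (map_tuple v args) = v (thead args).
  by rewrite /thead tnth_map.
have beheadE (v : regs) : [tuple of behead (map_tuple v args)] = map_tuple v rest.
  by apply: val_inj; rewrite /= behead_map.
have gargsE (u v : regs) j x : (forall k, k < b -> u k = v k) -> u b.+1 = j -> u b = x ->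
    map_tuple u [tuple of [:: b.+1, b & behead args]] =
    [tuple of [:: j, x & behead (map_tuple v args)]].
  move=> fr <- <-; apply: val_inj => /=; rewrite behead_map; congr [:: _, _ & _].
  by have /(congr1 val) := rest_frame _ _ fr.
have thead_lt : thead args < b by apply: args_lt; apply: mem_tnth.
pose body := Seq Pg (Seq (copy b b.+2) (Atom (Inc b.+1))).
exists (Seq Pf (Seq (Atom (Zero b.+1)) (Seq (Star body)
  (Seq (Atom (Same b.+1 (thead args))) (copy out b))))).
have ne_t : b != b.+2 by lia.
have ne_k : b != b.+1 by lia.
have ne_out : out != b by lia.
have ne_lt k : k < b -> (k == b = false) * (k == b.+1 = false) by move=> lt_k; split; lia.
have bodyP u u' : run body u u' ->
    [/\ rec_value g (map_tuple u [tuple of [:: b.+1, b & behead args]]) (u' b),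
        u' b.+1 = (u b.+1).+1 & forall k, k < b -> u' k = u k].
  move=> [u1 /g_sound[gu1 fru1] [_ /(run_copy _ _ ne_t)-> ->]].
  split=> [||k lt_k]; rewrite ?updE /upd.
  - by rewrite (negPf ne_k) eqxx.
  - by rewrite eq_sym (negPf ne_k) fru1 //; lia.
  - by rewrite !ne_lt // fru1 //; lia.
have bodyT u y : rec_value g (map_tuple u [tuple of [:: b.+1, b & behead args]]) y ->
    exists2 u', run body u u' & u' b = y.
  move=> /g_complete[u1 ru1 uy].
  exists (upd (upd u1 b (u1 b.+2)) b.+1 (upd u1 b (u1 b.+2) b.+1).+1).
    by exists u1 => //; exists (upd u1 b (u1 b.+2)) => //; apply/run_copy.
  by rewrite upd_neq // updE.
have initP v u0 : run Pf v u0 -> rec_value f (map_tuple v rest) (upd u0 b.+1 0 b) /\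
    forall k, k < b -> upd u0 b.+1 0 k = v k.
  move=> /f_sound[fu0 fr0]; split=> [|k lt_k]; first by rewrite upd_neq.
  by rewrite /upd ne_lt // fr0 ?ne_lt //; lia.
split=> [v w|v y].
  move=> [u0 /initP[fu0 fr0] [_ -> [u2 star_u]]] [_ [eq_n ->]].
  move=> /(run_copy _ _ ne_out)->.
  rewrite updE.
  (* Loop invariant: [h] lists the values computed up to the counter. *)
  pose J u := exists h, [/\ rec_value f (map_tuple v rest) (h 0),
      forall k, k < u b.+1 -> rec_value g
        [tuple of [:: k, h k & behead (map_tuple v args)]] (h k.+1),
      u b = h (u b.+1) & forall k, k < b -> u k = v k].
  have [h [h0 hS u2b fr2]] : J u2.
    apply: (star_inv (J := J)) star_u => [u u' [h [h0 hS ub fr]] /bodyP[gu uk fru']|].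
      exists (fun k => if k <= u b.+1 then h k else u' b); split=> //.
      - move=> k; rewrite uk ltnS => le_k; rewrite le_k.
        case: (ltnP k (u b.+1)) => [lt_k|ge_k]; first exact: hS.
        have -> : k = u b.+1 by lia.
        by have <- := gargsE u v (u b.+1) (h (u b.+1)) fr erefl ub.
      - by rewrite uk ltnn.
      - by move=> k lt_k; rewrite fru' // fr.
    by exists (fun=> upd u0 b.+1 0 b); split=> // k; rewrite updE.
  split=> [|k lt_k ne_out_k]; last by rewrite upd_neq // fr2.
  exists h; rewrite theadE -fr2 // -eq_n beheadE.
  by split.
move=> [h [h0 hS ->]]; rewrite theadE in hS *; rewrite beheadE in h0.
have [u0 ru0 u0b] := f_complete _ _ h0.
have [fu0 fr0] := initP _ _ ru0.
have [u [star_u ub uk fru]] : exists u, [/\ star (run body) (upd u0 b.+1 0) u,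
    u b = h (v (thead args)), u b.+1 = v (thead args) & forall k, k < b -> u k = v k].
  elim: (v (thead args)) hS => [_|j IHj hS].
    by exists (upd u0 b.+1 0); split; rewrite ?updE ?upd_neq //; apply: star_refl.
  have [|u [star_u ub uk fru]] := IHj; first by move=> k lt_k; apply: hS; lia.
  have [|u' ru' u'b] := bodyT u (h j.+1); first by rewrite (gargsE u v j (h j)) //; apply: hS.
  have [_ u'k fru'] := bodyP _ _ ru'.
  exists u'; split; rewrite ?u'k ?uk //; first exact: star_snoc ru'.
  by move=> k lt_k; rewrite fru' // fru.
exists (upd u out (u b)); last by rewrite updE.
exists u0 => //; exists (upd u0 b.+1 0) => //; exists u => //; exists u.
  by rewrite /= uk fru.
exact/run_copy.
Qed.

(** Register b is the candidate, b + 1 the value of f there, b + 2 scratch for the tests. Each round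
    checks that the value is positive before moving on, so f is defined and positive at all rejected
    candidates. *)
Lemma implements_min n (f : recfun n.+1) (args : n.-tuple nat) out b (Pf : prog) :
  all (fun r => r < b) args -> out < b -> out \notin args ->
  implements f [tuple of b :: args] b.+1 b.+3 Pf ->
  exists P, implements (RMin f) args out b P.
Proof.
move=> /allP args_lt out_lt out_args [f_sound f_complete].
have ne_q : b.+2 != b.+1 by lia.
have ne_out : out != b by lia.
have argsE (v u : regs) y : (forall k, k < b -> u k = v k) -> u b = y ->
    map_tuple u [tuple of b :: args] = [tuple of y :: map_tuple v args].
  move=> fr <-; apply: val_inj => /=; congr (_ :: _).
  by apply/eq_in_map => r /args_lt/fr.
pose body := Seq Pf (Seq (test_pos b.+2 b.+1) (Atom (Inc b))).
have bodyP u u' : run body u u' ->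
    [/\ exists k, rec_value f (map_tuple u [tuple of b :: args]) k.+1,
        u' b = (u b).+1 & forall k, k < b -> u' k = u k].
  move=> [u1 /f_sound[fu1 fr1] [_ /(run_test_pos _ _ ne_q)[gt0 ->] ->]].
  split=> [||k lt_k].
  - by exists (u1 b.+1).-1; rewrite prednK.
  - by rewrite updE upd_neq ?fr1 //; lia.
  - by rewrite !upd_neq ?fr1 //; lia.
have bodyT u k : rec_value f (map_tuple u [tuple of b :: args]) k.+1 ->
    exists u', run body u u'.
  move=> /f_complete[u1 ru1 u1z].
  exists (upd (upd u1 b.+2 (u1 b.+1)) b (upd u1 b.+2 (u1 b.+1) b).+1).
  exists u1 => //; exists (upd u1 b.+2 (u1 b.+1)) => //.
  by apply/run_test_pos => //; rewrite u1z.
exists (Seq (Atom (Zero b)) (Seq (Star body) (Seq Pf (Seq (test_zero b.+2 b.+1) (copy out b))))).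
pose J v u := (forall z, z < u b ->
    exists k, rec_value f [tuple of z :: map_tuple v args] k.+1) /\
  forall k, k < b -> u k = v k.
have loopP v u : star (run body) (upd v b 0) u -> J v u.
  apply: star_inv => [x x' [fx fr] /bodyP[[k fk] x'b fr']|].
    split=> [z|r lt_r]; last by rewrite fr' // fr.
    rewrite x'b ltnS leq_eqVlt => /predU1P[->|/fx //].
    by exists k; rewrite -(argsE v x).
  by split=> [z|k lt_k]; rewrite ?updE // upd_neq //; lia.
split=> [v w|v y [fy pos]].
  move=> [_ -> [u /loopP[pos fr] [u1 /f_sound[fu1 fr1]]]].
  move=> [_ /(run_test_zero _ _ ne_q)[u1z ->]] /(run_copy _ _ ne_out)->.
  have ub : u1 b = u b by apply: fr1; lia.
  rewrite updE upd_neq ?ub; last by lia.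
  split=> [|k lt_k ne_k]; last by rewrite !upd_neq // ?fr1 ?fr //; lia.
  by split=> //; rewrite -(argsE v u) // -u1z.
have [u [star_u ub fr]] : exists u, [/\ star (run body) (upd v b 0) u, u b = y &
    forall k, k < b -> u k = v k].
  elim: y pos {fy} => [_|y IHy pos].
    exists (upd v b 0); split; rewrite ?updE //; first exact: star_refl.
    by move=> k lt_k; rewrite upd_neq //; lia.
  have [|u [star_u ub fr]] := IHy; first by move=> z lt_z; apply: pos; lia.
  have [k fk] := pos y (ltnSn y).
  have [|u' ru'] := bodyT u k; first by rewrite (argsE v u y).
  have [_ u'b fr'] := bodyP _ _ ru'.
  exists u'; split; rewrite ?u'b ?ub //; first exact: star_snoc ru'.
  by move=> r lt_r; rewrite fr' // fr.
have [|u1 ru1 u1z] := f_complete u 0; first by rewrite (argsE v u y).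
have [_ fr1] := f_sound _ _ ru1.
exists (upd (upd u1 b.+2 0) out (upd u1 b.+2 0 b)).
  exists (upd v b 0) => //; exists u => //; exists u1 => //.
  by exists (upd u1 b.+2 0); [apply/run_test_zero | apply/run_copy].
by rewrite updE upd_neq ?fr1 //; lia.
Qed.

Lemma recfun_prog n (f : recfun n) (args : n.-tuple nat) out b :
  all (fun r => r < b) args -> out < b -> out \notin args ->
  exists P, implements f args out b P.
Proof.
elim: f args out b => {n} [n||n i|m n f IHf g IHg|n f IHf g IHg|n f IHf] args out b
  args_lt out_lt out_args.
- exists (Atom (Zero out)); split=> [v w ->|v _ ->].
    by rewrite updE; split=> // k _ ne_k; rewrite upd_neq.
  by exists (upd v out 0); rewrite ?updE.
- have ne : out != thead args by apply: contraNneq out_args => ->; apply: mem_tnth.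
  exists (Seq (copy out (thead args)) (Atom (Inc out))).
  split=> [v _ [_ /(run_copy _ _ ne)-> ->]|v _ ->].
    rewrite !updE /= /thead tnth_map; split=> // k _ ne_k.
    by rewrite !upd_neq.
  exists (upd (upd v out (v (thead args))) out (upd v out (v (thead args)) out).+1).
    by exists (upd v out (v (thead args))) => //; apply/run_copy.
  by rewrite !updE /thead tnth_map.
- have ne : out != tnth args i by apply: contraNneq out_args => ->; apply: mem_tnth.
  exists (copy out (tnth args i)); split=> [v _ /(run_copy _ _ ne)->|v _ ->].
    by rewrite /= updE tnth_map; split=> // k _ ne_k; rewrite upd_neq.
  exists (upd v out (v (tnth args i))); last by rewrite updE tnth_map.
  exact/run_copy.
- have Pg_ex i : exists Pg, implements (g i) args (b + i) (b + m) Pg.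
    apply: IHg; last 1 first.
    + by apply/negP => /(allP args_lt); lia.
    + by apply/allP => r /(allP args_lt); lia.
    + by rewrite ltn_add2l.
  have [Pg Pg_impl] := choice Pg_ex.
  have [|||Pf Pf_impl] := IHf [tuple b + i | i < m] out (b + m).
  + by apply/allP => _ /mapP[i _ ->]; rewrite ltn_add2l.
  + by rewrite ltn_addr.
  + by apply/mapP => -[i _ eo]; rewrite eo in out_lt; lia.
  exact: implements_comp Pg_impl Pf_impl.
- have rest_lt r : r \in behead args -> r < b by move=> /mem_behead/(allP args_lt).
  have [|||Pf Pf_impl] := IHf [tuple of behead args] b b.+3; try lia.
  + by apply/allP => r /rest_lt; lia.
  + by apply/negP => /rest_lt; lia.
  have [|||Pg Pg_impl] := IHg [tuple of [:: b.+1, b & behead args]] b.+2 b.+3; try lia.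
  + by apply/allP => r; rewrite !inE => /or3P[/eqP->|/eqP->|/rest_lt]; lia.
  + by rewrite !inE; apply/or3P => -[/eqP|/eqP|/rest_lt]; lia.
  exact: implements_prec Pf_impl Pg_impl.
- have [|||Pf Pf_impl] := IHf [tuple of b :: args] b.+1 b.+3; try lia.
  + by apply/allP => r; rewrite inE => /predU1P[->|/(allP args_lt)]; lia.
  + by rewrite inE; apply/orP => -[/eqP|/(allP args_lt)]; lia.
  exact: implements_min Pf_impl.
Qed.

(** * Automata and their computations *)

HB.instance Definition _ := gen_eqMixin act.
HB.instance Definition _ := gen_choiceMixin act.
HB.instance Definition _ := gen_eqMixin prog.
HB.instance Definition _ := gen_choiceMixin prog.

Lemma star_trans (T : Type) (R : T -> T -> Prop) u v w :
  star R u v -> star R v w -> star R u w.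
Proof. by elim=> // x y z Rxy _ IH /IH; apply: star_step. Qed.

Fixpoint runs (k : seq prog) (v w : regs) : Prop :=
  if k is P :: k' then exists2 u, run P v u & runs k' u w else w = v.

(* The states of the automaton of a program are the lists of programs that
   remain to be run. *)
Definition edge : Type := (seq prog * act * seq prog)%type.
Definition source (d : edge) := d.1.1.
Definition label (d : edge) := d.1.2.
Definition target (d : edge) := d.2.

Definition skip := Same 0 0.

(** There are infinitely many states, but running P in front of k meets only finitely many edges. *)
Fixpoint edges (P : prog) (k : seq prog) : seq edge :=
  match P with
  | Atom c => [:: (Atom c :: k, c, k)]
  | Seq P Q => (Seq P Q :: k, skip, [:: P, Q & k]) :: edges P (Q :: k) ++ edges Q k
  | Star P => [:: (Star P :: k, skip, k), (Star P :: k, skip, [:: P, Star P & k])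
               & edges P (Star P :: k)]
  end.

(** Stated backwards along an edge, so that a path followed from its end at the empty list
    accumulates a run. *)
Lemma edges_sound P k d v u w :
  d \in edges P k -> step (label d) v u -> runs (target d) u w -> runs (source d) v w.
Proof.
elim: P k => [c|P IHP Q IHQ|P IHP] k /=.
- by rewrite inE => /eqP-> /= c_vu ku; exists u.
- rewrite inE mem_cat => /or3P[/eqP-> /=|/IHP//|/IHQ//].
  by move=> [_ ->] [u1 Pu1 [u2 Qu2 ku]]; exists u2 => //; exists u1.
- rewrite !inE => /or3P[/eqP-> /=|/eqP-> /=|/IHP//].
    by move=> [_ ->] ku; exists v => //; apply: star_refl.
  move=> [_ ->] [u1 Pu1 [u2 Su2 ku]]; exists u2 => //.
  exact: star_step Su2.
Qed.

Definition move_along (E : seq edge) (x y : seq prog * regs) :=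
  exists2 c, (x.1, c, y.1) \in E & step c x.2 y.2.

Lemma edges_complete E P k v w : {subset edges P k <= E} -> run P v w ->
  star (move_along E) (P :: k, v) (k, w).
Proof.
have move1 x c y : (x.1, c, y.1) \in E -> step c x.2 y.2 -> star (move_along E) x y.
  by move=> xE xy; apply: star_step (star_refl _ _); exists c.
elim: P k v w => [c|P IHP Q IHQ|P IHP] k v w sub /=.
- by move=> cvw; apply: (move1 _ c) => //; apply: sub; rewrite mem_head.
- move=> [u Pu Qw]; apply: (@star_step _ _ _ ([:: P, Q & k], v)).
    by exists skip => //; apply: sub; rewrite mem_head.
  apply: star_trans (IHP _ _ _ _ Pu) (IHQ _ _ _ _ Qw) => d d_in; apply: sub.
    by rewrite inE mem_cat d_in orbT.
  by rewrite inE mem_cat d_in !orbT.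
- elim=> [u|x y z Pxy _ IH].
    by apply: (move1 _ skip) => //; apply: sub; rewrite mem_head.
  apply: (@star_step _ _ _ ([:: P, Star P & k], x)).
    by exists skip => //; apply: sub; rewrite !inE eqxx orbT.
  apply: star_trans (IHP _ _ _ _ Pxy) IH => d d_in; apply: sub.
  by rewrite !inE d_in !orbT.
Qed.

(** A loop at the final state makes every computation infinite, so that the rows beyond the goal can
    be filled too. *)
Definition idle : edge := ([::], skip, [::]).

Record trace (E : seq edge) (R : nat) (k : seq prog) (v w : regs)
    (d : nat -> edge) (vs : nat -> regs) (t bound : nat) : Prop := Trace {
  trace_edge : forall i, d i \in E;
  trace_source : source (d 0) = k;
  trace_init : vs 0 = v;
  trace_next : forall i, target (d i) = source (d i.+1);
  trace_step : forall i, step (label (d i)) (vs i) (vs i.+1);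
  trace_end : source (d t) = [::];
  trace_final : vs t = w;
  trace_bound : forall i r, r < R -> vs i r < bound }.

Lemma star_trace E R x w : idle \in E -> star (move_along E) x ([::], w) ->
  exists d vs t bound, trace E R x.1 x.2 w d vs t bound.
Proof.
move=> idleE; move Ey: ([::], w) => y xy.
have bounded (v : regs) : exists bound, forall r, r < R -> v r < bound.
  exists (\max_(r < R) v r).+1 => r lt_r; rewrite ltnS.
  exact: (leq_bigmax (F := fun r : 'I_R => v r) (Ordinal lt_r)).
elim: xy Ey => {x y} [x <-|x y z [c xE cxy] _ IH /IH] /=.
  have [bound bnd] := bounded w.
  by exists (fun=> idle), (fun=> w), 0, bound; split.
move=> [d [vs [t [bound [dE src init next stp fin val bnd]]]]].
have [bound' bnd'] := bounded x.2.
exists (fun i => if i is i'.+1 then d i' else (x.1, c, y.1)).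
exists (fun i => if i is i'.+1 then vs i' else x.2).
exists t.+1, (maxn bound' bound); split=> //.
- by case=> [|i].
- by case=> [|i] //=; rewrite src.
- by case=> [|i] //=; rewrite init.
- by case=> [|i] r lt_r; rewrite leq_max ?bnd' ?bnd ?orbT.
Qed.

(** * Tilings that simulate an automaton *)

Section Automaton.

Variables (E : seq edge) (R : nat) (k0 : seq prog).

(* Tracks: row starts, first row, start cell, goal cell; one track per register,
   whose bit at cell t * n + p says that the register has value p at time t; one
   track per edge, constant on rows, for the edge taken at time t. *)
Definition track : Type := ('I_4 + 'I_R.+1 + seq_sub E)%type.
HB.instance Definition _ := Finite.on track.

Definition row_track : track := inl (inl (inord 0)).
Definition first_track : track := inl (inl (inord 1)).
Definition start_track : track := inl (inl (inord 2)).
Definition goal_track : track := inl (inl (inord 3)).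
Definition reg_track (i : 'I_R.+1) : track := inl (inr i).
Definition edge_track (d : seq_sub E) : track := inr d.

Section Rule.

Variable r : {ffun track * 'I_4 -> bool}.
Let here (j : track) : bool := r (j, inord 0).
Let next (j : track) : bool := r (j, inord 1).
Let above (j : track) : bool := r (j, inord 2).
Let above_next (j : track) : bool := r (j, inord 3).

(** Registers are unary, with one marked column per row. [Zero] marks the row start; [Inc] moves the
    mark one column to the right, keeps the first column empty and forbids a mark in the last one;
    [Same] compares two tracks column by column. *)
Definition act_rule (c : act) : bool :=
  match c with
  | Zero k => [forall i : 'I_R.+1, above (reg_track i) ==
                 (if i == k :> nat then here row_track else here (reg_track i))]
  | Inc k => [forall i : 'I_R.+1, if i == k :> nat then
       [&& next row_track || (above_next (reg_track i) == here (reg_track i)),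
           here row_track ==> ~~ above (reg_track i)
         & here (reg_track i) ==> ~~ next row_track]
     else above (reg_track i) == here (reg_track i)]
  | Same k l =>
     [forall i : 'I_R.+1, above (reg_track i) == here (reg_track i)] &&
     [forall i : 'I_R.+1, forall j : 'I_R.+1, (i == k :> nat) && (j == l :> nat) ==>
       (here (reg_track i) == here (reg_track j))]
  end.

(** Row starts repeat with period n. First-row marks spread to the left, and a row start carrying
    one cannot have a cell to its left, which fixes the rows. Start and goal cells tie the ends to
    the states [k0] and [[::]]; edge marks spread along their row and must match those of the next
    row. *)
Definition rule : bool :=
  [&& [&& above row_track == here row_track,
          next first_track ==> here first_track,
          next first_track ==> ~~ next row_track,
          here first_track ==>
            [forall i : 'I_R.+1, here (reg_track i) == here row_track]
        & here start_track ==> [&& here row_track, ~~ here goal_track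
            & [exists d, (source (val d) == k0) && here (edge_track d)]]]
    & [&& here goal_track ==> here row_track &&
            [exists d, (source (val d) == [::]) && here (edge_track d)],
          here row_track ==> [exists d, here (edge_track d)],
          [forall d, here (edge_track d) ==> next row_track || next (edge_track d)],
          [forall d, forall d', [&& here row_track, here (edge_track d)
             & above (edge_track d')] ==> (target (val d) == source (val d'))]
        & [forall d, here (edge_track d) ==> act_rule (label (val d))]]].

End Rule.

Hypothesis label_lt : forall d, d \in E ->
  match label d with Zero i | Inc i => i < R.+1 | Same i j => (i < R.+1) && (j < R.+1) end.

Lemma window0 (x : track -> nat -> bool) n p j :
  window x n p (j, inord 0) = x j p.
Proof. by rewrite ffunE /offset inordK //= addn0. Qed.

Lemma window1 (x : track -> nat -> bool) n p j :
  window x n p (j, inord 1) = x j p.+1.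
Proof. by rewrite ffunE /offset inordK //= addn1. Qed.

Lemma window2 (x : track -> nat -> bool) n p j :
  window x n p (j, inord 2) = x j (p + n).
Proof. by rewrite ffunE /offset inordK. Qed.

Lemma window3 (x : track -> nat -> bool) n p j :
  window x n p (j, inord 3) = x j (p + n).+1.
Proof. by rewrite ffunE /offset inordK //= addnS. Qed.

Definition windowE := (window0, window1, window2, window3).

Definition decodes (x : track -> nat -> bool) n t (v : regs) :=
  forall i : 'I_R.+1, v i < n /\
    forall p, p < n -> x (reg_track i) (t * n + p) = (p == v i).

Lemma act_rule_sound x n t v c :
  (forall p, p < n -> x row_track (t * n + p) = (p == 0)) ->
  x row_track (t * n + n) ->
  (match c with Zero i | Inc i => i < R.+1 | Same i j => (i < R.+1) && (j < R.+1) end) ->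
  decodes x n t v ->
  (forall p, p < n -> act_rule (window x n (t * n + p)) c) ->
  exists2 w, step c v w & decodes x n t.+1 w.
Proof.
move=> rowE row_n c_lt dec rule_c.
have rowS p : p < n -> x row_track (t * n + p).+1 = (p.+1 == n).
  rewrite leq_eqVlt -addnS => /predU1P[->|lt_p]; first by rewrite row_n eqxx.
  by rewrite rowE //; lia.
have shift p : t.+1 * n + p = t * n + p + n by rewrite mulSn; lia.
case: c c_lt rule_c => [k|k|k l] /= lt_k rule_c.
- exists (upd v k 0) => // i; have [lt_v vE] := dec i; split.
    by rewrite /upd; case: (_ == _) => //; lia.
  move=> p lt_p; have /forallP/(_ i) := rule_c p lt_p.
  rewrite !windowE shift => /eqP->; rewrite /upd.
  by case: (_ == k); rewrite ?rowE ?vE.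
- have /= [lt_vk vkE] := dec (Ordinal lt_k).
  (* The mark of register k is not in the last column, so the incremented value still fits. *)
  have lt_vS : (v k).+1 < n.
    have /forallP/(_ (Ordinal lt_k)) := rule_c _ lt_vk.
    rewrite /= eqxx !windowE => /and3P[_ _].
    by rewrite vkE // eqxx rowS //=; lia.
  exists (upd v k (v k).+1) => // i; have [lt_v vE] := dec i; split.
    by rewrite /upd; case: eqP.
  move=> p lt_p; rewrite /upd; case: (eqVneq (i : nat) k) => [ei|ne_i]; last first.
    have /forallP/(_ i) := rule_c p lt_p.
    by rewrite (negPf ne_i) !windowE shift => /eqP->; rewrite vE.
  rewrite shift; case: p lt_p => [|p] lt_p.
    have /forallP/(_ i) := rule_c 0 lt_p.
    rewrite ei eqxx !windowE => /and3P[_ + _].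
    by rewrite rowE //= => /negPf->.
  have /forallP/(_ i) := rule_c p (ltnW lt_p).
  rewrite ei eqxx !windowE => /and3P[+ _ _].
  rewrite rowS 1?ltnW // => /orP[/eqP e|]; first by lia.
  by rewrite addnS addSn => /eqP->; rewrite vE ?ei // ltnW.
- case/andP: lt_k => lt_k lt_l.
  have /= [lt_vk vkE] := dec (Ordinal lt_k).
  have /= [lt_vl vlE] := dec (Ordinal lt_l).
  exists v.
    split=> //; have /andP[_ /forallP/(_ (Ordinal lt_k))/forallP/(_ (Ordinal lt_l))] :=
      rule_c _ lt_vk.
    by rewrite /= !eqxx !windowE vkE // vlE // eqxx /= => /eqP/esym/eqP.
  move=> i; have [lt_v vE] := dec i; split=> // p lt_p.
  have /andP[/forallP/(_ i) + _] := rule_c p lt_p.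
  by rewrite !windowE shift => /eqP->; rewrite vE.
Qed.

Lemma tiling_sound a :
  (forall d, d \in E -> forall v u w, step (label d) v u ->
     runs (target d) u w -> runs (source d) v w) ->
  (exists n' N x, tiling rule start_track first_track goal_track
                    (reg_track ord0) a n' N x) ->
  exists2 w, runs k0 (fun=> 0) w & w 0 = a.
Proof.
move=> E_sound [n' [N [x []]]]; set n := n' + a + 1; set L := N + n + 2.
move=> start0 first_last goalN regN ruleL.
have n_gt0 : 0 < n by rewrite /n; lia.
have rule1 p : p < L -> [/\ x row_track (p + n) = x row_track p,
    x first_track p.+1 -> x first_track p /\ ~~ x row_track p.+1
  & x first_track p -> forall i, x (reg_track i) p = x row_track p].
  move=> /ruleL/andP[/and5P[]]; rewrite !windowE => /eqP-> f1 f2 f3 _ _.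
  split=> // [f|f i]; first by rewrite f in f1 f2.
  by move: f3; rewrite f => /forallP/(_ i); rewrite !windowE => /eqP.
have [row0 ngoal0 [d0 src_d0 d0_0]] : [/\ x row_track 0, ~~ x goal_track 0
    & exists2 d, source (val d) = k0 & x (edge_track d) 0].
  have /ruleL/andP[/and5P[_ _ _ _]] : 0 < L by rewrite /L; lia.
  rewrite !windowE start0 => /and3P[-> -> /existsP[d]].
  by rewrite windowE => /andP[/eqP src xd]; split=> //; exists d.
have le_nL : n <= L by rewrite /L -addnA addnCA leq_addr.
have ltNL : N < L by rewrite /L addn2 ltnS leqW ?leq_addr.
have [rowN [dN src_dN dN_N]] : x row_track N /\
    exists2 d, source (val d) = [::] & x (edge_track d) N.
  have /ruleL/andP[_ /and5P[+ _ _ _ _]] := ltNL.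
  rewrite !windowE goalN => /andP[-> /existsP[d]].
  by rewrite windowE => /andP[/eqP src xd]; split=> //; exists d.
(* Leftwards from cell n - 1, whose mark is prescribed. *)
have first p : p < n -> x first_track p.
  move=> lt_p; have -> : p = n.-1 - (n.-1 - p) by rewrite subKn // -ltnS prednK.
  elim: (n.-1 - p) (leq_subr p n.-1) => [_|j IHj lt_j].
    by rewrite subn0 /n addn1.
  have lt_L : n.-1 - j.+1 < L.
    by apply: leq_trans le_nL; apply: (@leq_ltn_trans n.-1); rewrite ?leq_subr ?prednK.
  have e : (n.-1 - j.+1).+1 = n.-1 - j by rewrite subnSK.
  have [_ + _] := rule1 _ lt_L; rewrite e => f.
  by have [] := f (IHj (ltnW lt_j)).
have rowE t p : p < n -> t * n + p < L -> x row_track (t * n + p) = (p == 0).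
  move=> lt_p; elim: t => [_|t IHt lt_L].
    rewrite add0n; case: p lt_p => [|p] lt_p; first by rewrite row0.
    have lt_L : p < L by apply: leq_trans le_nL; apply: ltnW.
    have [_ /(_ (first _ lt_p))[_ /negPf->] _] := rule1 p lt_L.
    by [].
  have lt_L' : t * n + p < L.
    by apply: leq_ltn_trans lt_L; rewrite mulSn -addnA leq_addl.
  have [+ _ _] := rule1 _ lt_L'.
  by rewrite IHt // mulSn => <-; congr (x _ _); rewrite -addnA [RHS]addnC.
pose T := N %/ n.
(* The goal cell is a row start, hence lies in column 0. *)
have eN : N = T * n.
  move: (divn_eq N n) ltNL rowN => {1 2}->.
  rewrite -/T => lt_L; rewrite rowE ?ltn_mod // => /eqP e.
  by rewrite [LHS](divn_eq N n) e addn0.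
have T_gt0 : 0 < T.
  by rewrite lt0n; apply: contraNneq ngoal0 => T0; rewrite -[0](mul0n n) -T0 -eN.
have row_lt t p : t < T -> p < n -> t * n + p < N.
  move=> lt_t lt_p; rewrite eN; apply: (@leq_trans (t.+1 * n)).
    by rewrite mulSn addnC ltn_add2r.
  by rewrite leq_mul2r lt_t orbT.
have row_n t : t <= T -> x row_track (t * n).
  move=> le_t; rewrite -[t * n]addn0 rowE // addn0.
  by apply: leq_ltn_trans ltNL; rewrite eN leq_mul2r le_t orbT.
have edge_row t d : t < T -> x (edge_track d) (t * n) ->
    forall p, p < n -> x (edge_track d) (t * n + p).
  move=> lt_t xd; elim=> [|p IHp] lt_p; first by rewrite addn0.
  have lt_L : t * n + p.+1 < L by apply: ltn_trans (row_lt _ _ lt_t lt_p) ltNL.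
  have /ruleL/andP[_ /and5P[_ _ /forallP/(_ d) + _ _]] : t * n + p < L.
    by apply: ltnW; rewrite addnS in lt_L.
  rewrite !windowE IHp ?(ltnW lt_p) // -addnS rowE //.
(* Induction on the number s of rows before the goal. A row may carry several edges; one is chosen
   in each row, and in row T it has to be one whose source is the empty list. *)
have sound s t v d : t + s = T -> decodes x n t v -> x (edge_track d) (t * n) ->
    (t = T -> source (val d) = [::]) ->
    exists2 w, runs (source (val d)) v w & decodes x n T w.
  elim: s t v d => [|s IHs] t v d.
    by rewrite addn0 => -> dec _ /(_ erefl)->; exists v.
  move=> e_ts dec xd _; have lt_t : t < T by rewrite -e_ts addnS ltnS leq_addr.
  have lt_L p : p < n -> t * n + p < L.
    by move=> lt_p; apply: ltn_trans (row_lt _ _ lt_t lt_p) ltNL.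
  have [||||u vu dec_u] := @act_rule_sound x n t v (label (val d)) _ _ _ dec _.
  - by move=> p lt_p; rewrite rowE // lt_L.
  - by rewrite addnC -mulSn row_n.
  - exact/label_lt/valP.
  - move=> p lt_p; have /ruleL/andP[_ /and5P[_ _ _ _ /forallP/(_ d)]] := lt_L p lt_p.
    by rewrite windowE edge_row.
  have [d' xd' end_d'] : exists2 d', x (edge_track d') (t.+1 * n) &
      (t.+1 = T -> source (val d') = [::]).
    have [e_T|ne_T] := eqVneq t.+1 T; first by exists dN => //; rewrite e_T -eN.
    have /ruleL/andP[_ /and5P[_ + _ _ _]] : t.+1 * n < L.
      by apply: leq_ltn_trans ltNL; rewrite eN leq_mul2r lt_t orbT.
    rewrite windowE row_n // => /existsP[d'].
    by rewrite windowE => xd'; exists d' => // /eqP; rewrite (negPf ne_T).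
  have [|w uw dec_w] := IHs t.+1 u d' _ dec_u xd' end_d'; first by rewrite addSnnS.
  exists w => //; apply: E_sound vu _; first exact: valP.
  have /ruleL/andP[_ /and5P[_ _ _ /forallP/(_ d)/forallP/(_ d') + _]] :
    t * n < L by rewrite -[t * n]addn0 lt_L.
  rewrite !windowE row_n ?(ltnW lt_t) // xd.
  have -> : t * n + n = t.+1 * n by rewrite mulSn addnC.
  by rewrite xd' => /eqP->.
have [||||w kw dec_w] := sound T 0 (fun=> 0) d0.
- by [].
- move=> i; split=> // p lt_p; rewrite mul0n add0n.
  have lt_L := leq_trans lt_p le_nL.
  have [_ _ /(_ (first p lt_p) i) ->] := rule1 p lt_L.
  by rewrite -[p]/(0 * n + p) rowE.
- by rewrite mul0n.
- by move=> T0; rewrite -T0 in T_gt0.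
exists w; first by rewrite -src_d0.
have [_ /(_ a)] := dec_w ord0.
rewrite -eN regN => /(_ _)/esym/eqP e; rewrite e //.
by rewrite /n addn1 ltnS leq_addl.
Qed.

Lemma tiling_complete w d vs t bound :
  k0 != [::] -> trace E R.+1 k0 (fun=> 0) w d vs t bound ->
  exists n' N x, tiling rule start_track first_track goal_track
                   (reg_track ord0) (w 0) n' N x.
Proof.
move=> k0_neq [dE d0 vs0 d_next d_step d_end vs_t vs_bound].
have t_gt0 : 0 < t by rewrite lt0n; apply: contra_neq k0_neq => t0; rewrite -d0 -d_end t0.
(* Wide enough for one column beyond every register value and for column [w 0]. *)
set n := bound + w 0 + 1.
pose X (j : track) q r := match j with
  | inl (inl i) => nth false [:: r == 0; q == 0; (q == 0) && (r == 0); (q == t) && (r == 0)] i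
  | inl (inr i) => r == vs q i
  | inr e => val e == d q
  end.
pose x j p := X j (p %/ n) (p %% n).
have n_gt0 : 0 < n by rewrite /n; lia.
have xE j q r : r < n -> x j (q * n + r) = X j q r.
  by move=> lt_r; rewrite /x divnMDl // modnMDl divn_small // modn_small // addn0.
have XrowE q r : X row_track q r = (r == 0) by rewrite /X /= inordK.
have XfirstE q r : X first_track q r = (q == 0) by rewrite /X /= inordK.
have XstartE q r : X start_track q r = (q == 0) && (r == 0) by rewrite /X /= inordK.
have XgoalE q r : X goal_track q r = (q == t) && (r == 0) by rewrite /X /= inordK.
have XregE i q r : X (reg_track i) q r = (r == vs q i) by [].
have XedgeE e q r : X (edge_track e) q r = (val e == d q) by [].
have vs_lt q (i : 'I_R.+1) : (vs q i).+1 < n.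
  by rewrite /n addn1 ltnS (leq_trans (vs_bound q i (ltn_ord i))) ?leq_addr.
have edge_ex q : exists e : seq_sub E, val e = d q by exists (SeqSub (dE q)).
exists bound, (t * n), x; split.
- by have := xE start_track 0 0 n_gt0; rewrite XstartE => ->.
- have lt_n : bound + w 0 < n by rewrite /n addn1.
  by have := xE first_track 0 _ lt_n; rewrite XfirstE mul0n add0n => ->.
- by rewrite -[t * n]addn0 xE // XgoalE !eqxx.
- by rewrite xE /= ?vs_t //; rewrite /n addn1 ltnS leq_addl.
move=> p _; rewrite (divn_eq p n) -/n.
move: (p %/ n) (p %% n) (ltn_pmod p n_gt0) => q r lt_r {p}.
have hereE j : x j (q * n + r) = X j q r by apply: xE.
have aboveE j : x j (q * n + r + n) = X j q.+1 r.
  by rewrite -xE // mulSn addnC addnA.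
(* The cell following column r of row q is in column [r1] of row [q + carry]. *)
pose r1 := if r.+1 < n then r.+1 else 0.
pose carry : nat := ~~ (r.+1 < n).
have r1_lt : r1 < n by rewrite /r1; case: ifP.
have nextP q' : (q' * n + r).+1 = (q' + carry) * n + r1.
  rewrite /carry /r1; case: ltnP => [_|ge_r] /=; first by rewrite addn0 addnS.
  rewrite addn0 mulnDl mul1n -addnS; congr (_ + _).
  by apply/eqP; rewrite eqn_leq lt_r.
have nextE j : x j (q * n + r).+1 = X j (q + carry) r1 by rewrite nextP xE.
have above_nextE j : x j (q * n + r + n).+1 = X j (q.+1 + carry) r1.
  by rewrite -xE // -nextP mulSn addnAC [n + _]addnC.
have xwE := (window0, window1, window2, window3, hereE, aboveE, nextE, above_nextE,
             XrowE, XfirstE, XstartE, XgoalE, XregE, XedgeE).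
have carryE : (r1 == 0) = (carry != 0) by rewrite /r1 /carry; case: ifP.
apply/andP; split; apply/and5P; split; rewrite ?xwE //.
- by apply/implyP; rewrite addn_eq0 => /andP[].
- by apply/implyP; rewrite addn_eq0 carryE => /andP[_ /eqP->].
- apply/implyP => /eqP q0; apply/forallP => i; rewrite !xwE.
  by rewrite q0 vs0.
- apply/implyP => /andP[/eqP q0 r0]; apply/and3P; split=> //.
    by rewrite q0 r0 andbT eq_sym -lt0n.
  have [e ee] := edge_ex 0; apply/existsP; exists e.
  by rewrite !xwE ee d0 eqxx q0 /= eqxx.
- apply/implyP => /andP[/eqP qt ->]; rewrite andTb.
  have [e ee] := edge_ex t; apply/existsP; exists e.
  by rewrite !xwE ee d_end eqxx qt /= eqxx.
- apply/implyP => _; have [e ee] := edge_ex q; apply/existsP; exists e.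
  by rewrite !xwE ee.
- apply/forallP => e; rewrite !xwE carryE.
  by case: (eqVneq carry 0) => [->|_]; rewrite ?implybT // addn0 implybb.
- apply/forallP => e; apply/forallP => e'; rewrite !xwE.
  by apply/implyP => /and3P[_ /eqP-> /eqP->]; rewrite d_next.
- apply/forallP => e; rewrite !xwE; apply/implyP => /eqP->.
  have := d_step q; case: (label (d q)) => [k|k|k l] /=.
  + move=> vsS; apply/forallP => i; rewrite !xwE vsS /upd.
    by case: (_ == k).
  + move=> vsS; apply/forallP => i.
    case: eqVneq => [ei|ne_i]; rewrite !xwE; last by rewrite vsS upd_neq.
    apply/and3P; split.
    * rewrite carryE; case: (eqVneq carry 0) => //= c0.
      have -> : r1 = r.+1 by move: c0; rewrite /r1 /carry; case: ifP.
      by rewrite c0 addn0 vsS ei updE eqSS.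
    * by apply/implyP => /eqP->; rewrite vsS ei updE.
    * apply/implyP => /eqP er; rewrite carryE /carry negbK eqb0 negbK.
      by rewrite er vs_lt.
  + move=> [eq_v vsS]; apply/andP; split.
      by apply/forallP => i; rewrite !xwE vsS.
    apply/forallP => i; apply/forallP => j; apply/implyP => /andP[/eqP ei /eqP ej].
    by rewrite !xwE ei ej eq_v.
Qed.

End Automaton.

Lemma run_tiling (P : prog) : exists (T : finType)
    (phi : pred {ffun T * 'I_4 -> bool}) (ts tu tg ti : T), forall a,
  (exists2 w, run P (fun=> 0) w & w 0 = a) <->
  exists n' N x, tiling phi ts tu tg ti a n' N x.
Proof.
pose E := idle :: edges P [::].
pose top c := match c with Zero i | Inc i => i | Same i j => maxn i j end.
pose R := \max_(d <- E) top (label d).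
have label_lt d : d \in E -> match label d with
    Zero i | Inc i => i < R.+1 | Same i j => (i < R.+1) && (j < R.+1) end.
  move=> dE; have : top (label d) <= R by apply: leq_bigmax_seq dE _.
  by case: (label d) => //= i j; rewrite geq_max !ltnS.
exists (track E R), (@rule E R [:: P]), (start_track E R), (first_track E R),
  (goal_track E R), (reg_track E ord0).
move=> a; split=> [[w Pw <-]|/(tiling_sound label_lt)].
  have idleE : idle \in E by rewrite mem_head.
  have sub : {subset edges P [::] <= E} by move=> d dP; rewrite inE dP orbT.
  have [d [vs [t [bound tr]]]] := star_trace R.+1 idleE (edges_complete sub Pw).
  exact: tiling_complete tr.
case=> [d + v u w|w [u Pu ->] wa]; last by exists u.
rewrite inE => /predU1P[->|dP]; last exact: edges_sound dP.
by move=> /= [_ eu] ew; rewrite ew.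
Qed.

Theorem re_exponential (A : nat -> Prop) : recursively_enumerable A ->
  exists E : seq (expr 9 * expr 9), forall a,
    A a <-> exists2 v : 'I_9 -> nat, v ord0 = a & nat_solution E v.
Proof.
move=> [f fA].
have [|||P [P_sound P_complete]] := @recfun_prog _ f [tuple 0] 1 2; rewrite ?inE //.
(* The input is guessed into register 0, which P preserves, so it can be read off at the end. *)
pose guess := Seq (Star (Atom (Inc 0))) P.
have [T [phi [ts [tu [tg [ti tilingP]]]]]] := run_tiling guess.
have [E EP] := tiling_exponential phi ts tu tg ti.
exists E => a; rewrite -EP -tilingP fA.
have valE (v : regs) : map_tuple v [tuple 0] = [tuple v 0] by apply: val_inj.
split=> [[y fy]|[w [u /run_star_inc[c ->] Pw] <-]].
  have guessed : run (Star (Atom (Inc 0))) (fun=> 0) (upd (fun=> 0) 0 a).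
    by apply/run_star_inc; exists a.
  have [|w Pw wy] := P_complete (upd (fun=> 0) 0 a) y; first by rewrite valE updE.
  exists w; first by exists (upd (fun=> 0) 0 a).
  by have [_ ->] := P_sound _ _ Pw.
have [fw fr] := P_sound _ _ Pw; exists (w 1).
by rewrite fr // -valE.
Qed.

(** * Rational unknowns *)

Local Open Scope ring_scope.

Lemma rat_ge0_frac (q : rat) : 0 <= q ->
  exists a d : nat, (0 < d)%N /\ q * d%:R = a%:R.
Proof.
move=> q_ge0; exists `|numq q|%N, `|denq q|%N; split.
  by rewrite absz_gt0 denq_eq0.
rewrite -{1}[q]divq_num_den.
rewrite !natr_absz !ger0_norm ?denq_ge0 ?numq_ge0 //.
by rewrite divfK // intr_eq0 denq_eq0.
Qed.

Lemma logn_prod_primes (m : nat) (p a : 'I_m -> nat) (i : 'I_m) :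
  injective p -> (forall k, prime (p k)) ->
  logn (p i) (\prod_k p k ^ a k)%N = a i.
Proof.
move=> p_inj p_pr; have p_gt0 k : (0 < p k ^ a k)%N by rewrite expn_gt0 prime_gt0.
rewrite (bigD1 i) //= lognM ?prodn_cond_gt0 //.
rewrite lognX logn_prime // eqxx muln1 logn_coprime ?addn0 //.
elim/big_rec: _ => [|k x ne_ki IH]; first exact: coprimen1.
rewrite coprimeMr IH andbT coprimeXr // prime_coprime // dvdn_prime2 //.
by apply: contra_neqN ne_ki => /eqP/p_inj.
Qed.

(* If the p_k^{q_k} multiply to a rational z, raise to a common denominator D of
   the q_k: then D divides each exponent D q_k of the integer z^D. *)
Lemma prod_prime_powR_rat (R : realType) (m : nat) (p : 'I_m -> nat)
    (q : 'I_m -> rat) (z : rat) :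
  injective p -> (forall k, prime (p k)) -> (forall k, 0 <= q k) ->
  0 <= z -> \prod_k (p k)%:R `^ (ratr (q k)) = ratr z :> R ->
  forall k, exists n : nat, q k = n%:R.
Proof.
move=> p_inj p_pr q_ge0 z_ge0 eq_z.
have [D D_gt0 qD] : exists2 D : nat, (0 < D)%N &
    forall k, exists a : nat, q k * D%:R = a%:R.
  have /choice[d d_pos] : forall k, exists d : nat,
      (0 < d)%N /\ exists a : nat, q k * d%:R = a%:R.
    by move=> k; have [a [d [d0 e]]] := rat_ge0_frac (q_ge0 k); exists d; split=> //; exists a.
  exists (\prod_k d k)%N; first by apply: prodn_gt0 => k; have [] := d_pos k.
  move=> k; have [_ [a qa]] := d_pos k.
  exists (a * \prod_(j | j != k) d j)%N.
  by rewrite (bigD1 k) //= !natrM mulrA qa.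
have {qD}/choice[a qa] := qD.
have prod_gt0 : (0 < \prod_k p k ^ a k)%N.
  by apply: prodn_gt0 => k; rewrite expn_gt0 prime_gt0.
have [u [w [w_gt0 zw]]] := rat_ge0_frac z_ge0.
have eq_nat : ((\prod_k p k ^ a k) * w ^ D = u ^ D)%N.
  apply/eqP; rewrite -(eqr_nat rat) natrM !natrX -zw exprMn; apply/eqP.
  congr (_ * _); apply: (fmorph_inj (@ratr R)).
  rewrite rmorphXn /= -eq_z ratr_nat natr_prod -prodrXl; apply: eq_bigr => k _.
  rewrite -powR_mulrn ?powR_ge0 // -powRrM natrX -powR_mulrn ?ler0n //.
  by rewrite -(ratr_nat R D) -rmorphM qa /= ratr_nat.
move=> k; exists (a k %/ D)%N.
have DK : (D %| a k)%N.
  have u_gt0 : (0 < u)%N.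
    have : (0 < u ^ D)%N by rewrite -eq_nat muln_gt0 prod_gt0 expn_gt0 w_gt0.
    by rewrite expn_gt0 eqn0Ngt D_gt0 orbF.
  (* Valuations at [p k] give [a k] plus a multiple of D on one side and a multiple of D on the
     other. *)
  have := congr1 (logn (p k)) eq_nat.
  rewrite lognM ?expn_gt0 ?w_gt0 // !lognX logn_prod_primes //.
  by move=> /(congr1 (dvdn D)); rewrite dvdn_addl ?dvdn_mulr.
apply: (mulIf (x := D%:R)); first by rewrite pnatr_eq0 -lt0n.
by rewrite qa -natrM divnK.
Qed.

Section Nonnegative.

Variables (R : realType) (n : nat) (v : n.-tuple rat).
Hypothesis v_ge0 : forall i, 0 <= tnth v i.

Lemma eval_ge0 e : 0 <= eval R v e.
Proof.
elim: e => [i|k|e1 IH1 e2 IH2|e1 IH1 e2 IH2|e1 _ e2 _] /=.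
- by rewrite ler0q.
- exact: ler0n.
- exact: addr_ge0.
- exact: mulr_ge0.
- exact: powR_ge0.
Qed.

Lemma admissible_ge0 e : admissible R v e.
Proof. by elim: e => //= *; split=> //; apply: eval_ge0. Qed.

Definition sum_expr (s : seq (expr n)) := foldr (@Add n) (Cst 0) s.

(* The sum of the (l - r)^2, with the negative terms on the other side. *)
Definition conj_eq (E : seq (expr n * expr n)) : edeq n :=
  EDEq (sum_expr [seq Add (Mul lr.1 lr.1) (Mul lr.2 lr.2) | lr <- E])
       (sum_expr [seq Mul (Cst 2) (Mul lr.1 lr.2) | lr <- E]).

(** With nonnegative variables every exponentiation is admissible, and a sum of real squares
    vanishes only termwise. *)
Lemma solution_conj_eq E :
  solution R (conj_eq E) v <-> all (fun lr => eval R v lr.1 == eval R v lr.2) E.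
Proof.
have -> : solution R (conj_eq E) v <->
    \sum_(lr <- E) (eval R v lr.1 - eval R v lr.2) ^+ 2 == 0.
  have -> : \sum_(lr <- E) (eval R v lr.1 - eval R v lr.2) ^+ 2 =
      eval R v (pos_part (conj_eq E)) - eval R v (neg_part (conj_eq E)).
    rewrite /conj_eq /=; elim: E => [|[l r] E IHE] /=; first by rewrite big_nil subr0.
    by rewrite big_cons IHE /= opprD addrACA; congr (_ + _); rewrite sqrrB; ring.
  split=> [[_ _ ->]//|/eqP e0]; split=> //; exact: admissible_ge0.
suff -> : (\sum_(lr <- E) (eval R v lr.1 - eval R v lr.2) ^+ 2 == 0) =
    all (fun lr => eval R v lr.1 == eval R v lr.2) E by [].
elim: E => [|lr E IHE]; first by rewrite big_nil eqxx.
rewrite big_cons paddr_eq0 ?sqr_ge0 //; last by apply: sumr_ge0 => *; apply: sqr_ge0.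
by rewrite sqrf_eq0 subr_eq0 IHE.
Qed.

End Nonnegative.

(** * Eight natural unknowns from ten squares of rationals *)

Definition prime_nth (i : 'I_8) := nth 0 [:: 2; 3; 5; 7; 11; 13; 17; 19]%N i.

Lemma prime_nth_prime i : prime (prime_nth i).
Proof. by case: i => [[|[|[|[|[|[|[|[|i]]]]]]]]]. Qed.

Lemma prime_nth_inj : injective prime_nth.
Proof.
move=> i j /eqP; rewrite nth_uniq ?ltn_ord //; first by move/eqP/val_inj.
Qed.

(** The first eight unknowns carry the natural numbers, the ninth the product of prime powers, and
    the tenth a number of square 1/4. *)
Definition digit_var (k : 'I_8) : 'I_10 := widen_ord (isT : (8 <= 10)%N) k.
Definition prod_var : 'I_10 := Ordinal (isT : (8 < 10)%N).

(* The last unknown is forced to be 1/4, so that this is a square root. *)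
Definition sqrt_expr (j : 'I_10) : expr 11 :=
  Pow (Var (lift ord0 j)) (Add (Var ord_max) (Var ord_max)).

Fixpoint lift_expr (e : expr 9) : expr 11 :=
  match e with
  | Var i => if unlift ord0 i is Some k then sqrt_expr (digit_var k) else Var ord0
  | Cst k => Cst k
  | Add e1 e2 => Add (lift_expr e1) (lift_expr e2)
  | Mul e1 e2 => Mul (lift_expr e1) (lift_expr e2)
  | Pow e1 e2 => Pow (lift_expr e1) (lift_expr e2)
  end.

Definition prime_prod_expr : expr 11 :=
  foldr (@Mul 11) (Cst 1)
    [seq Pow (Cst (prime_nth k)) (sqrt_expr (digit_var k)) | k <- enum 'I_8].

Definition rational_eqs (E : seq (expr 9 * expr 9)) : seq (expr 11 * expr 11) :=
  [:: (Mul (Cst 4) (Var ord_max), Cst 1), (prime_prod_expr, sqrt_expr prod_var)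
    & [seq (lift_expr lr.1, lift_expr lr.2) | lr <- E]].

Definition args (a : nat) (x : 10.-tuple rat) : 11.-tuple rat :=
  [tuple of a%:R :: squares x].

Section Rational.

Variables (R : realType) (a : nat) (x : 10.-tuple rat).
Let v := args a x.

Lemma tnth_args0 : tnth v ord0 = a%:R.
Proof. exact: tnth0. Qed.

Lemma tnth_argsS j : tnth v (lift ord0 j) = tnth x j ^+ 2.
Proof. by rewrite tnthS tnth_mktuple. Qed.

Lemma args_ge0 i : 0 <= tnth v i.
Proof.
case: (unliftP ord0 i) => [j|] ->; last by rewrite tnth_args0 ler0n.
by rewrite tnth_argsS sqr_ge0.
Qed.

Lemma eval_last : eval R v (Var ord_max) = ratr (tnth x ord_max) ^+ 2.
Proof.
have -> : ord_max = lift ord0 ord_max :> 'I_11 by apply: val_inj.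
by rewrite /= tnth_argsS rmorphXn.
Qed.

Lemma eval_sqrt j : 4 * ratr (tnth x ord_max) ^+ 2 = 1 :> R ->
  eval R v (sqrt_expr j) = ratr `|tnth x j|.
Proof.
move=> e4; rewrite /sqrt_expr.
have -> : eval R v (Pow (Var (lift ord0 j)) (Add (Var ord_max) (Var ord_max))) =
  eval R v (Var (lift ord0 j)) `^ (eval R v (Var ord_max) + eval R v (Var ord_max)) by [].
have -> : eval R v (Var ord_max) + eval R v (Var ord_max) = 2^-1.
  by rewrite eval_last; move: e4; set h := _ ^+ 2 => e4; lra.
by rewrite /= tnth_argsS rmorphXn /= powR12_sqrt ?sqr_ge0 // sqrtr_sqr ratr_norm.
Qed.

Lemma eval_lift w e : 4 * ratr (tnth x ord_max) ^+ 2 = 1 :> R -> w ord0 = a ->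
  (forall k, `|tnth x (digit_var k)| = (w (lift ord0 k))%:R) ->
  eval R v (lift_expr e) = (neval w e)%:R.
Proof.
move=> e4 w0 wE; elim: e => [i|k|e1 IH1 e2 IH2|e1 IH1 e2 IH2|e1 IH1 e2 IH2] //=.
- case: unliftP => [k|] ->; first by rewrite eval_sqrt // wE ratr_nat.
  by rewrite /= tnth_args0 ratr_nat w0.
- by rewrite IH1 IH2 natrD.
- by rewrite IH1 IH2 natrM.
- by rewrite IH1 IH2 powR_mulrn ?ler0n // natrX.
Qed.

Lemma eval_prime_prod : 4 * ratr (tnth x ord_max) ^+ 2 = 1 :> R ->
  eval R v prime_prod_expr =
  \prod_k (prime_nth k)%:R `^ (ratr `|tnth x (digit_var k)|).
Proof.
move=> e4; rewrite /prime_prod_expr -big_enum /=.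
elim: (enum 'I_8) => [|k s IHs]; first by rewrite big_nil.
by rewrite big_cons -IHs /= -(eval_sqrt (digit_var k) e4).
Qed.

(** The second equation makes the product of prime powers rational, so the first eight unknowns have
    natural absolute values and the lifted equations become those of E. *)
Lemma rational_eqsP E :
  solution R (conj_eq (rational_eqs E)) v ->
  exists2 w : 'I_9 -> nat, w ord0 = a & nat_solution E w.
Proof.
move=> /(solution_conj_eq _ args_ge0).
move=> /and3P[/eqP e4 /eqP eP eE].
have {}e4 : 4 * ratr (tnth x ord_max) ^+ 2 = 1 :> R by rewrite -eval_last.
have {eP} : eval R v prime_prod_expr = eval R v (sqrt_expr prod_var) := eP.
rewrite eval_prime_prod // eval_sqrt // => eP.
have /choice[w wE] := prod_prime_powR_rat prime_nth_inj prime_nth_prime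
  (fun k => normr_ge0 _) (normr_ge0 _) eP.
pose w' i := if unlift ord0 i is Some k then w k else a.
have w'0 : w' ord0 = a by rewrite /w' unlift_none.
exists w' => //.
elim: E eE => //= lr E IHE /andP[elr /IHE ->]; rewrite andbT.
by rewrite -(eqr_nat R) -!eval_lift // => k; rewrite /w' liftK wE.
Qed.

End Rational.

Lemma rational_eqs_sol (R : realType) E a (w : 'I_9 -> nat) :
  w ord0 = a -> nat_solution E w ->
  exists x, solution R (conj_eq (rational_eqs E)) (args a x).
Proof.
move=> w0 wE.
(* The natural values themselves, the product of prime powers, and 1/2, whose square is 1/4. *)
pose s : seq rat := [seq (w (lift ord0 k))%:R | k <- enum 'I_8] ++
  [:: \prod_k (prime_nth k)%:R ^+ w (lift ord0 k); 2^-1].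
pose x := [tuple nth 0 s i | i < 10]; exists x.
have size_s : size [seq (w (lift ord0 k))%:R : rat | k <- enum 'I_8] = 8.
  by rewrite size_map size_enum_ord.
have e4 : 4 * ratr (tnth x ord_max) ^+ 2 = 1 :> R.
  by rewrite tnth_mktuple nth_cat size_s /= fmorphV /= ratr_nat; field.
have xE k : `|tnth x (digit_var k)| = (w (lift ord0 k))%:R.
  rewrite tnth_mktuple nth_cat size_s /= ltn_ord (nth_map k) ?size_enum_ord //.
  by rewrite nth_ord_enum ger0_norm ?ler0n.
apply/(solution_conj_eq R (args_ge0 a x)); apply/and3P; split.
- by apply/eqP; rewrite -[RHS]e4 -(eval_last R a x).
- apply/eqP; rewrite [LHS](eval_prime_prod _ e4) [RHS](eval_sqrt _ _ e4).
  rewrite tnth_mktuple nth_cat size_s /= ger0_norm; last first.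
    by apply: prodr_ge0 => k _; rewrite exprn_ge0 ?ler0n.
  rewrite rmorph_prod; apply: eq_bigr => k _.
  by rewrite xE ratr_nat powR_mulrn ?ler0n // rmorphXn /= ratr_nat.
elim: E wE => //= lr E IHE /andP[/eqP elr /IHE ->]; rewrite andbT.
by rewrite !(@eval_lift _ _ _ w) // elr.
Qed.

Theorem re_rational_exponential (R : realType) (A : nat -> Prop) :
  recursively_enumerable A ->
  exists F : edeq 11, forall a : nat,
    A a <-> exists x : 10.-tuple rat, solution R F [tuple of a%:R :: squares x].
Proof.
move=> /re_exponential[E AE]; exists (conj_eq (rational_eqs E)) => a; rewrite AE.
split=> [[w w0 wE]|[x /rational_eqsP//]].
exact: rational_eqs_sol w0 wE.
Qed.

(** * Undecidability *)

Local Open Scope nat_scope.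

Lemma rec_value_functional n (f : recfun n) v y z :
  rec_value f v y -> rec_value f v z -> y = z.
Proof.
elim: f v y z => {n} [n||n i|m n f IHf g IHg|n f IHf g IHg|n f IHf] v y z /=.
1-3: by move=> -> ->.
- move=> [w [gw fw]] [w' [gw' fw']].
  have ew : w = w' by apply: eq_from_tnth => i; apply: IHg (gw i) (gw' i).
  by rewrite ew in fw; apply: IHf fw fw'.
- move=> [s [s0 sS ->]] [s' [s0' sS' ->]].
  elim: (thead v) sS sS' => [_ _|k IHk sS sS']; first exact: IHf s0 s0'.
  have e : s k = s' k by apply: IHk => j lt_j; [apply: sS | apply: sS']; apply: ltnW.
  have := sS' k (ltnSn k); rewrite -e; exact: IHg (sS k (ltnSn k)).
- move=> [fy py] [fz pz]; case: (ltngtP y z) => // lt_yz.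
  + by have [k fk] := pz _ lt_yz; have := IHf _ _ _ fy fk.
  + by have [k fk] := py _ lt_yz; have := IHf _ _ _ fz fk.
Qed.

(** * Computable total functions and codes *)

Definition computable n (F : n.-tuple nat -> nat) :=
  exists f : recfun n, forall v y, rec_value f v y <-> y = F v.

Definition computable1 h := computable (fun v : 1.-tuple nat => h (tnth v ord0)).
Definition computable2 h :=
  computable (fun v : 2.-tuple nat => h (tnth v ord0) (tnth v (inord 1))).
Definition computable3 h := computable (fun v : 3.-tuple nat =>
  h (tnth v ord0) (tnth v (inord 1)) (tnth v (inord 2))).

Lemma computable_ext n (F G : n.-tuple nat -> nat) :
  F =1 G -> computable F -> computable G.
Proof. by move=> eFG [f fF]; exists f => v y; rewrite fF eFG. Qed.

Lemma computable_comp m n (G : m.-tuple nat -> nat) (F : 'I_m -> n.-tuple nat -> nat) :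
  computable G -> (forall i, computable (F i)) ->
  computable (fun v => G [tuple F i v | i < m]).
Proof.
move=> [g gG] /choice[f fF]; exists (RComp g f) => v y /=; split=> [[w [fw gw]]|->].
  have -> : [tuple F i v | i < m] = w.
    by apply: eq_from_tnth => i; rewrite tnth_mktuple; have /fF := fw i.
  exact/gG.
exists [tuple F i v | i < m]; split=> [i|]; last exact/gG.
by rewrite tnth_mktuple; apply/fF.
Qed.

Lemma computable_proj n (i : 'I_n) : computable (fun v => tnth v i).
Proof. by exists (RProj i). Qed.

Lemma computable_app1 n h (F : n.-tuple nat -> nat) :
  computable1 h -> computable F -> computable (fun v => h (F v)).
Proof.
move=> ch cF; have cF1 (i : 'I_1) : computable F by [].
by apply: computable_ext (computable_comp ch cF1) => v; rewrite tnth_mktuple.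
Qed.

Lemma computable_app2 n h (F G : n.-tuple nat -> nat) :
  computable2 h -> computable F -> computable G ->
  computable (fun v => h (F v) (G v)).
Proof.
move=> ch cF cG.
have cFG (i : 'I_2) : computable (if i == 0 :> nat then F else G) by case: ifP.
apply: computable_ext (computable_comp ch cFG) => v.
by rewrite !tnth_mktuple inordK.
Qed.

Lemma computable_app3 n h (F G H : n.-tuple nat -> nat) :
  computable3 h -> computable F -> computable G -> computable H ->
  computable (fun v => h (F v) (G v) (H v)).
Proof.
move=> ch cF cG cH.
have cFGH (i : 'I_3) : computable
  (if i == 0 :> nat then F else if i == 1 :> nat then G else H) by case: ifP => _ //; case: ifP.
apply: computable_ext (computable_comp ch cFGH) => v.
by rewrite !tnth_mktuple !inordK.
Qed.

Lemma computable_succ : computable1 succn.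
Proof. by exists RSucc => v y; rewrite /= /thead. Qed.

Lemma computable_const n c : @computable n (fun=> c).
Proof.
elim: c => [|c IHc]; first by exists (RZero n).
exact: computable_app1 computable_succ IHc.
Qed.

Lemma computable_rec b S : computable1 b -> computable3 S ->
  computable2 (fun k x => nat_rect (fun=> nat) (b x) (fun j s => S j s x) k).
Proof.
move=> [f fb] [g gS]; exists (RPrec f g) => v y /=.
have e1 : thead v = tnth v ord0 by [].
have e2 : tnth [tuple of behead v] ord0 = tnth v (inord 1).
  by rewrite !(tnth_nth 0) /= inordK // nth_behead.
have e3 j s : [/\ tnth [tuple of [:: j, s & behead v]] ord0 = j,
    tnth [tuple of [:: j, s & behead v]] (inord 1) = s
  & tnth [tuple of [:: j, s & behead v]] (inord 2) = tnth v (inord 1)].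
  by rewrite !(tnth_nth 0) /= !inordK //= nth_behead.
set h := nat_rect _ _ _; rewrite e1.
split=> [[s [s0 sS ->]]|->].
  elim: (tnth v ord0) sS => [_|k IHk sS] /=; first by have /fb -> := s0; rewrite e2.
  have /gS -> := sS k (ltnSn k); have [-> -> ->] := e3 k (s k).
  by rewrite IHk // => j lt_j; apply: sS; apply: ltnW.
exists h; split=> // [|k _]; first by apply/fb; rewrite e2.
by apply/gS; have [-> -> ->] := e3 k (h k).
Qed.

Lemma computable2_swap h : computable2 h -> computable2 (fun x y => h y x).
Proof. by move=> ch; apply: computable_app2 ch _ _; apply: computable_proj. Qed.

Lemma computable_rec0 b S : computable2 S ->
  computable1 (nat_rect (fun=> nat) b S).
Proof.
move=> cS; have cS3 : computable3 (fun j s _ => S j s).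
  by apply: (computable_app2 cS); apply: computable_proj.
have cr := computable_rec (computable_const 1 b) cS3.
exact: (computable_app2 cr (computable_proj ord0) (computable_proj ord0)).
Qed.

Lemma computable_add : computable2 addn.
Proof.
have cS : computable3 (fun _ s _ => s.+1).
  by apply: (computable_app1 computable_succ); apply: computable_proj.
apply: computable_ext (computable_rec (computable_proj ord0) cS) => v.
by elim: (tnth v ord0) => //= k ->.
Qed.

Lemma computable_mul : computable2 muln.
Proof.
have cS : computable3 (fun _ s x => x + s).
  by apply: (computable_app2 computable_add); apply: computable_proj.
apply: computable_ext (computable_rec (computable_const _ 0) cS) => v.
by elim: (tnth v ord0) => //= k ->; rewrite mulSn.
Qed.

Lemma computable_pred : computable1 predn.
Proof.
have cS : computable2 (fun k _ => k) by apply: computable_proj.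
apply: computable_ext (computable_rec0 0 cS) => v.
by case: (tnth v ord0).
Qed.

Lemma computable_sub : computable2 subn.
Proof.
have cS : computable3 (fun _ s _ => s.-1).
  by apply: (computable_app1 computable_pred); apply: computable_proj.
suff main : computable2 (fun x y => y - x) by exact: computable2_swap main.
apply: computable_ext (@computable_rec id _ (computable_proj ord0) cS) => v.
elim: (tnth v ord0) => [|k IHk] /=; first by rewrite subn0.
by rewrite IHk subnS.
Qed.

(** The terms [1 - C] and [1 - (1 - C)] are the indicators of C = 0 and C > 0, and they select the
    branch arithmetically. *)
Lemma computable_ifz n (C F G : n.-tuple nat -> nat) :
  computable C -> computable F -> computable G ->
  computable (fun v => if C v == 0 then F v else G v).
Proof.
move=> cC cF cG; have c1 := computable_const n 1.
have cN : computable (fun v => 1 - C v) by apply: computable_app2 computable_sub _ _.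
have cNN : computable (fun v => 1 - (1 - C v)) by apply: computable_app2 computable_sub _ _.
apply: computable_ext (computable_app2 computable_add
  (computable_app2 computable_mul cN cF) (computable_app2 computable_mul cNN cG)) => v.
by case: (C v) => [|k]; rewrite /= ?mul0n ?mul1n ?addn0 ?add0n // !mul1n.
Qed.

Definition triangle (n : nat) := nat_rect (fun=> nat) 0 (fun k s => s + k.+1) n.

Lemma triangleE n : triangle n = 'C(n.+1, 2).
Proof. by elim: n => [|n IHn] //=; rewrite [in RHS]binS bin1 IHn. Qed.

Lemma cantorE a b : cantor a b = triangle (a + b) + b.
Proof. by rewrite triangleE. Qed.

(* The integer triangular root: triangle (root c) <= c < triangle (root c).+1. *)
Definition root (c : nat) := nat_rect (fun=> nat) 0
  (fun k r => if triangle r.+1 - k.+1 == 0 then r.+1 else r) c.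

Definition snd_code c := c - triangle (root c).
Definition fst_code c := root c - snd_code c.

(** Since b < a + b + 1, the code lies between two consecutive triangular numbers. *)
Lemma root_cantor a b : root (cantor a b) = a + b.
Proof.
have mono m n : m <= n -> triangle m <= triangle n.
  by move=> le_mn; rewrite !triangleE leq_bin2l.
have triangleS n : triangle n.+1 = triangle n + n.+1 by [].
have rootS c : root c.+1 = if triangle (root c).+1 <= c.+1 then (root c).+1 else root c.
  by rewrite /root /= subn_eq0.
have rootP c : triangle (root c) <= c < triangle (root c).+1.
  elim: c => [|c /andP[le_c lt_c]] //; rewrite rootS.
  case: (leqP (triangle (root c).+1) c.+1) => [le_S|lt_S]; last by rewrite lt_S andbT leqW.
  rewrite le_S (triangleS (root c).+1); move: lt_c; move: (triangle _) => T; lia.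
have := rootP (cantor a b); set r := root _; rewrite cantorE => /andP[le_r lt_r].
case: (ltngtP r (a + b)) => // /mono; last by rewrite triangleS; lia.
by move: lt_r; lia.
Qed.

Lemma snd_cantor a b : snd_code (cantor a b) = b.
Proof. by rewrite /snd_code root_cantor cantorE addKn. Qed.

Lemma fst_cantor a b : fst_code (cantor a b) = a.
Proof. by rewrite /fst_code snd_cantor root_cantor addnK. Qed.

(** Makes subexpressions have smaller codes, as looking them up in the table requires. *)
Lemma cantor_ge a b : a + b + b <= cantor a b.
Proof.
rewrite cantorE leq_add2r; elim: (a + b) => //= n IHn.
by rewrite addnS ltnS; lia.
Qed.

Lemma computable_triangle : computable1 triangle.
Proof.
apply: computable_rec0; apply: computable_app2 computable_add _ _.
  exact: computable_proj.
by apply: computable_app1 computable_succ _; apply: computable_proj.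
Qed.

Lemma computable_root : computable1 root.
Proof.
apply: computable_rec0; apply: computable_ifz; last exact: computable_proj.
  apply: computable_app2 computable_sub _ _.
    apply: computable_app1 computable_triangle _.
    by apply: computable_app1 computable_succ _; apply: computable_proj.
  by apply: computable_app1 computable_succ _; apply: computable_proj.
by apply: computable_app1 computable_succ _; apply: computable_proj.
Qed.

Lemma computable_snd : computable1 snd_code.
Proof.
apply: computable_app2 computable_sub (computable_proj _) _.
apply: computable_app1 computable_triangle _.
exact: computable_root.
Qed.

Lemma computable_fst : computable1 fst_code.
Proof. exact: computable_app2 computable_sub computable_root computable_snd. Qed.

Lemma computable_cantor : computable2 cantor.
Proof.
have cb : computable (fun v : 2.-tuple nat => tnth v (inord 1)) by apply: computable_proj.
apply: computable_ext (computable_app2 computable_add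
  (computable_app1 computable_triangle computable_add) cb) => v.
by rewrite cantorE.
Qed.

(* Course-of-values recursion: [table c a] lists, as iterated Cantor pairs, the
   results of the substitution of the constant a for the variable 0 in the
   expressions of codes c - 1, ..., 0. *)
Definition lookup T k := fst_code (nat_rect (fun=> nat) T (fun _ s => snd_code s) k).

(** Tag 0 is a variable: index 0 becomes the constant a, the others drop by one. Tag 1 is a
    constant; other tags are binary, and the result for code j stands at place [c - 1 - j] of the
    table. *)
Definition subst_step a c T :=
  if fst_code c == 0 then
    if snd_code c == 0 then cantor 1 a else cantor 0 (snd_code c).-1
  else if (fst_code c).-1 == 0 then c else
  cantor (fst_code c) (cantor (lookup T (c.-1 - fst_code (snd_code c)))
                              (lookup T (c.-1 - snd_code (snd_code c)))).

Definition table c a :=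
  nat_rect (fun=> nat) 0 (fun c T => cantor (subst_step a c T) T) c.

Definition subst_code a c := subst_step a c (table c a).

Lemma lookup_table a c j : j < c -> lookup (table c a) (c.-1 - j) = subst_code a j.
Proof.
move=> lt_jc.
have iterE k : k <= c ->
    nat_rect (fun=> nat) (table c a) (fun _ s => snd_code s) k = table (c - k) a.
  elim: k => [|k IHk] lt_k; first by rewrite subn0.
  by rewrite /= IHk ?(ltnW lt_k) // -(subnSK lt_k) /= snd_cantor.
rewrite /lookup iterE; last by lia.
have -> : c - (c.-1 - j) = j.+1 by lia.
by rewrite /= fst_cantor.
Qed.

Fixpoint subst_expr n (a : nat) (e : expr n.+1) : expr n :=
  match e with
  | Var i => if unlift ord0 i is Some j then Var j else Cst a
  | Cst k => Cst k
  | Add e1 e2 => Add (subst_expr a e1) (subst_expr a e2)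
  | Mul e1 e2 => Mul (subst_expr a e1) (subst_expr a e2)
  | Pow e1 e2 => Pow (subst_expr a e1) (subst_expr a e2)
  end.

Lemma subst_code_expr n a (e : expr n.+1) :
  subst_code a (expr_code e) = expr_code (subst_expr a e).
Proof.
have node t x y z w : 2 <= t -> subst_code a x = z -> subst_code a y = w ->
    subst_code a (cantor t (cantor x y)) = cantor t (cantor z w).
  move=> ge2 xz yw; rewrite /subst_code /subst_step fst_cantor !snd_cantor fst_cantor.
  have := cantor_ge t (cantor x y); have := cantor_ge x y => ge_xy ge_c.
  case: t ge2 ge_c => [|[|t]] // _ ge_c; rewrite /=.
  by rewrite !lookup_table ?xz ?yw //; lia.
elim: e => [i|k|e1 IH1 e2 IH2|e1 IH1 e2 IH2|e1 IH1 e2 IH2] /=;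
  [| | exact: node | exact: node | exact: node].
- rewrite /subst_code /subst_step fst_cantor snd_cantor /=.
  by case: unliftP => [j|] ->.
- by rewrite /subst_code /subst_step fst_cantor.
Qed.

Ltac computability := first
  [ exact: computable_const | exact: computable_proj
  | apply: (computable_app1 computable_succ); computability
  | apply: (computable_app1 computable_pred); computability
  | apply: (computable_app1 computable_fst); computability
  | apply: (computable_app1 computable_snd); computability
  | apply: (computable_app2 computable_sub); computability
  | apply: (computable_app2 computable_cantor); computability ].

Lemma computable_lookup : computable2 lookup.
Proof.
have cS : computable3 (fun _ s _ => snd_code s) by rewrite /computable3; computability.
have := @computable_rec id _ (computable_proj ord0) cS.
by move/computable2_swap/(computable_app1 computable_fst).
Qed.

Lemma computable_subst_step : computable3 subst_step.
Proof.
have c_lookup n (F G : n.+3.-tuple nat -> nat) : computable F -> computable G ->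
  computable (fun v => lookup (F v) (G v)) by apply: computable_app2 computable_lookup.
rewrite /computable3 /subst_step.
apply: computable_ifz; first by computability.
  by apply: computable_ifz; computability.
apply: computable_ifz; [by computability | by computability |].
apply: (computable_app2 computable_cantor); first by computability.
by apply: (computable_app2 computable_cantor); apply: c_lookup; computability.
Qed.

Lemma computable_subst_code : computable2 subst_code.
Proof.
have cS : computable3 (fun c T a => cantor (subst_step a c T) T).
  apply: (computable_app2 computable_cantor); last by computability.
  by apply: (computable_app3 computable_subst_step); computability.
have c_table : computable2 table := computable_rec (computable_const _ 0) cS.
apply: (computable_app3 computable_subst_step); try by computability.
by apply: (computable_app2 c_table); computability.
Qed.

Definition diagonal_code (F : nat) :=
  cantor (subst_code F (fst_code F)) (subst_code F (snd_code F)).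

Lemma computable_diagonal : computable1 diagonal_code.
Proof.
by apply: (computable_app2 computable_cantor);
  apply: (computable_app2 computable_subst_code); computability.
Qed.

Definition subst_edeq n a (F : edeq n.+1) : edeq n :=
  EDEq (subst_expr a (pos_part F)) (subst_expr a (neg_part F)).

Lemma diagonal_codeE n (F : edeq n.+1) :
  diagonal_code (edeq_code F) = edeq_code (subst_edeq (edeq_code F) F).
Proof.
by rewrite /diagonal_code {2 4}/edeq_code fst_cantor snd_cantor !subst_code_expr.
Qed.

Lemma solution_subst (R : realType) n a (F : edeq n.+1) (v : n.-tuple rat) :
  solution R (subst_edeq a F) v <-> solution R F [tuple of (a%:R)%R :: v].
Proof.
have evalE e : eval R v (subst_expr a e) = eval R [tuple of (a%:R)%R :: v] e.
  elim: e => [i|k|e1 IH1 e2 IH2|e1 IH1 e2 IH2|e1 IH1 e2 IH2] //=; rewrite ?IH1 ?IH2 //.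
  by case: unliftP => [j|] -> /=; rewrite ?tnthS ?tnth0 ?ratr_nat.
have admE e : admissible R v (subst_expr a e) <-> admissible R [tuple of (a%:R)%R :: v] e.
  elim: e => [i|k|e1 IH1 e2 IH2|e1 IH1 e2 IH2|e1 IH1 e2 IH2] //=.
  - by case: unliftP.
  1-2: by split=> -[/IH1 ? /IH2 ?].
  by rewrite !evalE; split=> -[/IH1 ? /IH2 ? ? ?].
rewrite /solution /= !evalE.
by split=> -[/admE ? /admE ? ?].
Qed.

(** A minimization whose body ignores the search variable halts, necessarily at 0, exactly when
    f(h(a)) = 0. *)
Lemma re_preimage_value0 (f : recfun 1) (h : nat -> nat) :
  computable1 h -> recursively_enumerable (fun a => rec_value f [tuple h a] 0).
Proof.
move=> [s sh].
pose arg (_ : 'I_1) : recfun 2 := RComp s (fun _ : 'I_1 => RProj (inord 1)).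
have argE y a z : rec_value (arg ord0) [tuple y; a] z <-> z = h a.
  rewrite /=; split=> [[w [wE /sh->]]|->].
    by rewrite (wE ord0) (tnth_nth 0) /= inordK.
  exists [tuple a]; split; last by apply/sh.
  by move=> i; rewrite !(tnth_nth 0) /= inordK // ord1.
have compE y a z : rec_value (RComp f arg) [tuple y; a] z <-> rec_value f [tuple h a] z.
  split=> [[w [wE fw]]|fz].
    suff -> : [tuple h a] = w by [].
    by apply: eq_from_tnth => i; rewrite ord1; symmetry; apply/(argE y); exact: wE.
  by exists [tuple h a]; split=> // i; apply/argE; rewrite ord1.
exists (RMin (RComp f arg)) => a; split=> [fa|[y [fy _]]].
  by exists 0; split=> //; apply/compE.
exact/(compE y a).
Qed.

Theorem theorem1p2 (R : realType) :
  (forall A : nat -> Prop, recursively_enumerable A ->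
     exists F : edeq 11, forall a : nat,
       A a <-> exists x : 10.-tuple rat,
         solution R F [tuple of (a%:R)%R :: squares x])
  /\
  ~ decidable_edeq (fun F : edeq 10 =>
      exists x : 10.-tuple rat, solution R F (squares x)).
Proof.
split=> [A reA|[f f_dec]]; first exact: re_rational_exponential.
have [F FP] := re_rational_exponential R (re_preimage_value0 f computable_diagonal).
have := FP (edeq_code F); rewrite diagonal_codeE.
(* At the code of F itself, the set represented by F speaks of G: G is solvable iff f gives it the
   value 0. *)
set G := subst_edeq _ F => GP.
have GE : (exists x, solution R G (squares x)) <-> rec_value f [tuple edeq_code G] 0.
  by rewrite GP; split=> -[x /solution_subst sol]; exists x => //; apply/solution_subst.
have [G_yes G_no] := f_dec G.
have no : ~ exists x, solution R G (squares x).
  by move=> yes; have := rec_value_functional (G_yes yes) (iffLR GE yes).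
by apply: (no); apply/GE; apply: G_no.
Qed.
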